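(* Fix $\epsilon,R\in(0,1)$ and let $\beta=\beta(n)>-1$ be a sequence of real numbers and $N=N(n)>n$ a sequence of natural numbers. Then $$\lim_{n\to\infty}\frac{\mathbb{E}\,V_n(H_{N,n}^\beta\cap R^{-1}B_2^n)}{V_n(R^{-1}B_2^n)}=\begin{cases}1 & \text{if } N\le\exp\left((1-\epsilon)\left(\beta+\frac{n+1}{2}\right)\log\left((1-R^2)^{-1}\right)\right)\text{ for all sufficiently large } n,\\ 0 & \text{if } N\ge\exp\left((1+\epsilon)\left(\beta+\frac{n+1}{2}\right)\log\left((1-R^2)^{-1}\right)\right)\text{ for all sufficiently large } n.\end{cases}$$
   Context: $B_2^n$ is the closed Euclidean unit ball in $\mathbb{R}^n$ and $V_n$ is $n$-dimensional Lebesgue measure. For $\beta>-1$, $\nu_\beta$ is the beta distribution, i.e. the probability measure on $B_2^n$ with density proportional to $(1-\|x\|^2)^\beta$. For $N>n$ and independent random points $X_1,\ldots,X_N$ with distribution $\nu_\beta$, $H_{N,n}^\beta:=\{x\in\mathbb{R}^n:\langle X_i,x\rangle\le1\text{ for each } i=1,\ldots,N\}$. *)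

(* Defs.v *)
From HB Require Import structures.
From mathcomp Require Import all_boot all_order all_algebra.
From mathcomp Require Import all_classical all_reals all_analysis.
From mathcomp Require Import measurable_realfun.

Set Implicit Arguments.
Unset Strict Implicit.
Unset Printing Implicit Defensive.

Import Order.TTheory GRing.Theory Num.Theory.
Import numFieldNormedType.Exports.

Local Open Scope classical_set_scope.
Local Open Scope ring_scope.

(* R^n is [n.-tuple R], which the library equips with the product (i.e. Borel)
   sigma-algebra; matrices carry no measurable structure. *)

Section euclidean.
Context {R : realType} {n : nat}.
Implicit Types x y : n.-tuple R.

Definition dotp x y : R := \sum_(i < n) tnth x i * tnth y i.

Definition enorm x : R := Num.sqrt (dotp x x).

Definition eball (r : R) : set (n.-tuple R) := [set x | enorm x <= r].

Lemma measurable_dotp y : measurable_fun [set: n.-tuple R] (dotp ^~ y).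
Proof.
apply: measurable_sum => i.
by apply: measurable_funM => //; exact: measurable_tnth.
Qed.

Lemma measurable_enorm : measurable_fun [set: n.-tuple R] enorm.
Proof.
apply: (measurableT_comp (continuous_measurable_fun (@sqrt_continuous R))).
apply: measurable_sum => i.
by apply: measurable_funM; exact: measurable_tnth.
Qed.

Lemma measurable_eball r : measurable (eball r).
Proof.
rewrite (_ : eball r = enorm @^-1` `]-oo, r]).
  by rewrite -[X in measurable X]setTI; exact: measurable_enorm.
by apply/seteqP; split => x /=; rewrite /eball /= in_itv.
Qed.

End euclidean.

(* The canonical sigma-finite structure on [m1 \x m2] is not found by inference
   (the instance for sub-probabilities takes precedence). *)
Lemma sigma_finite_product d1 d2 (T1 : measurableType d1)
    (T2 : measurableType d2) (R : realType)
    (m1 : {sigma_finite_measure set T1 -> \bar R})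
    (m2 : {sigma_finite_measure set T2 -> \bar R}) :
  sigma_finite [set: T1 * T2] (m1 \x m2)%E.
Proof.
have /sigma_finiteP[F [TF ndF Foo]] := sigma_finiteT m1.
have /sigma_finiteP[G [TG ndG Goo]] := sigma_finiteT m2.
exists (fun k => F k `*` G k).
  rewrite -setXTT TF TG predeqE => -[x y]; split.
    move=> [/= [i _ Fx] [j _ Gy]]; exists (maxn i j) => //; split.
    - by move: x Fx; exact/subsetPset/ndF/leq_maxl.
    - by move: y Gy; exact/subsetPset/ndG/leq_maxr.
  by move=> [i _ []/= ? ?]; split; exists i.
move=> k; have [? ?] := Foo k; have [? ?] := Goo k.
split; first exact: measurableX.
by rewrite product_measure1E// lte_mul_pinfty// ge0_fin_numE.
Qed.

Section lebesgue_succ.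
Local Open Scope ereal_scope.
Context {R : realType} {n : nat}.
Variable mu : {sigma_finite_measure set (n.-tuple R) -> \bar R}.

Definition consp (p : R * n.-tuple R) : n.+1.-tuple R := [tuple of p.1 :: p.2].

Lemma measurable_consp : measurable_fun [set: R * n.-tuple R] consp.
Proof. exact: (measurable_cons measurable_fst measurable_snd). Qed.

Definition lebesgue_succ : set (n.+1.-tuple R) -> \bar R :=
  pushforward (@lebesgue_measure R \x mu) consp.

Let lebesgue_succ0 : lebesgue_succ set0 = 0.
Proof. by rewrite /lebesgue_succ /pushforward preimage_set0 measure0. Qed.

Let lebesgue_succ_ge0 A : 0 <= lebesgue_succ A.
Proof. by rewrite /lebesgue_succ /pushforward measure_ge0. Qed.

Let lebesgue_succ_sigma_additive : semi_sigma_additive lebesgue_succ.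
Proof.
move=> F mF tF mUF; rewrite /lebesgue_succ /pushforward preimage_bigcup.
apply: measure_semi_sigma_additive.
- by move=> i; rewrite -[X in measurable X]setTI; exact: measurable_consp.
- apply/trivIsetP => /= i j _ _ ij; rewrite -preimage_setI.
  by move/trivIsetP : tF => /(_ _ _ _ _ ij) ->//; rewrite preimage_set0.
- by rewrite -preimage_bigcup -[X in measurable X]setTI; exact: measurable_consp.
Qed.

HB.instance Definition _ := isMeasure.Build _ _ _ lebesgue_succ
  lebesgue_succ0 lebesgue_succ_ge0 lebesgue_succ_sigma_additive.

Let lebesgue_succ_sigma_finite : sigma_finite [set: n.+1.-tuple R] lebesgue_succ.
Proof.
have [F FT Foo] : sigma_finite setT (@lebesgue_measure R \x mu).
  exact: sigma_finite_product.
pose uncons (t : n.+1.-tuple R) : R * n.-tuple R :=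
  (tnth t ord0, [tuple of behead t]).
have unconsK t : consp (uncons t) = t.
  by apply: val_inj => /=; rewrite [in RHS](tuple_eta t).
have conspK p : uncons (consp p) = p.
  by case: p => a b; congr (_, _); apply: val_inj.
have muncons : measurable_fun [set: n.+1.-tuple R] uncons.
  by apply: measurable_fun_pair; [exact: measurable_tnth|exact: measurable_behead].
exists (fun k => uncons @^-1` F k).
  apply/seteqP; split => // t _; have : [set: R * n.-tuple R] (uncons t) by [].
  by rewrite FT => -[k _ Fk]; exists k.
move=> k; have [mFk Fkoo] := Foo k; split.
  by rewrite -[X in measurable X]setTI; exact: muncons.
rewrite /lebesgue_succ /pushforward (_ : _ @^-1` _ = F k)//.
by apply/seteqP; split => p /=; rewrite conspK.
Qed.

HB.instance Definition _ := Measure_isSigmaFinite.Build _ _ _ lebesgue_succ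
  lebesgue_succ_sigma_finite.

End lebesgue_succ.

Fixpoint lebesgue_tuple (R : realType) (n : nat) :
    {sigma_finite_measure set (n.-tuple R) -> \bar R} :=
  if n is m.+1 then lebesgue_succ (lebesgue_tuple R m)
  else @dirac _ (0.-tuple R) [tuple] R.

Arguments lebesgue_tuple {R} n.

Lemma lebesgue_tuple_box (R : realType) (n : nat) (A : 'I_n -> set R) :
  (forall i, measurable (A i)) ->
  lebesgue_tuple n [set x | forall i, A i (tnth x i)] =
  (\big[*%E/1]_(i < n) @lebesgue_measure R (A i))%E.
Proof.
elim: n A => [|n IHn] A mA.
  by rewrite big_ord0 /= diracE mem_set //; case.
rewrite big_ord_recl -(IHn (fun i => A (lift ord0 i)))//.
rewrite -product_measure1E; last 2 first.
  exact: mA.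
  rewrite (_ : [set _ | _] = \bigcap_(i in [set: 'I_n])
      ((fun x => tnth x i) @^-1` (A (lift ord0 i)))).
    apply: fin_bigcap_measurable => // i _.
    by rewrite -[X in measurable X]setTI; exact: measurable_tnth.
  by apply/seteqP; split => x /=; [move=> h i _; exact: h|move=> h i; exact: h].
suff E : consp @^-1` [set x | forall i, A i (tnth x i)] =
    A ord0 `*` [set x : n.-tuple R | forall i, A (lift ord0 i) (tnth x i)].
  exact: (congr1 (@lebesgue_measure R \x lebesgue_tuple n)%E E).
apply/seteqP; split => -[a b] /=.
  move=> h; split; first exact: (h ord0).
  by move=> i; have := h (lift ord0 i); rewrite tnthS.
move=> [h0 h] i.
by case: (unliftP ord0 i) => [j ->|->//]; rewrite tnthS; exact: h.
Qed.

Section beta_distribution.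
Local Open Scope ereal_scope.
Context {R : realType} (n : nat) (b : R).

Definition beta_density (x : n.-tuple R) : R := ((1 - enorm x ^+ 2) `^ b)%R.

Definition beta_mass (A : set (n.-tuple R)) : \bar R :=
  \int[lebesgue_tuple n]_(x in A `&` eball 1) (beta_density x)%:E.

Lemma measurable_beta_density :
  measurable_fun [set: n.-tuple R] beta_density.
Proof.
apply: (measurableT_comp (measurable_powR b)).
by apply: measurable_funB => //; apply: measurable_funX; exact: measurable_enorm.
Qed.

Let beta_mass0 : beta_mass set0 = 0.
Proof. by rewrite /beta_mass set0I integral_set0. Qed.

Let beta_mass_ge0 A : 0 <= beta_mass A.
Proof. by apply: integral_ge0 => x _; rewrite lee_fin powR_ge0. Qed.

Let beta_mass_sigma_additive : semi_sigma_additive beta_mass.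
Proof.
move=> F mF tF mUF; rewrite /beta_mass setI_bigcupl.
rewrite ge0_integral_bigcup//=.
- by apply: is_cvg_ereal_nneg_natsum => k _; exact: beta_mass_ge0.
- by move=> k; apply: measurableI => //; exact: measurable_eball.
- apply/measurable_funTS/measurable_EFinP; exact: measurable_beta_density.
- by move=> x _; rewrite lee_fin powR_ge0.
- exact: trivIset_setIr.
Qed.

HB.instance Definition _ := isMeasure.Build _ _ _ beta_mass
  beta_mass0 beta_mass_ge0 beta_mass_sigma_additive.

(* The total mass [beta_mass setT] lies in ]0, +oo[ as soon as -1 < b, so the
   second argument of [mnormalize] (its value when the mass is 0 or +oo) is
   irrelevant. *)
Definition beta_distr : probability (n.-tuple R) R :=
  mnormalize beta_mass (@dirac _ (n.-tuple R) [tuple 0%R | i < n] R).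

End beta_distribution.

Definition mutually_independent d d' (T : measurableType d)
    (T' : measurableType d') (R : realType) (P : probability T R) (I : finType)
    (X : I -> {RV P >-> T'}) : Prop :=
  forall (J : {set I}) (B : I -> set T'), (forall i, measurable (B i)) ->
    P (\bigcap_(i in [set` J]) X i @^-1` B i) =
    (\big[*%E/1]_(i in J) P (X i @^-1` B i))%E.

Definition polytope (R : realType) (n N : nat) (X : 'I_N -> n.-tuple R) :
    set (n.-tuple R) :=
  [set x | forall i, dotp (X i) x <= 1].

Definition expected_volume_ratio (R : realType) d (T : measurableType d)
    (P : probability T R) (n N : nat) (X : 'I_N -> {RV P >-> (n.-tuple R)})
    (r : R) : R :=
  fine 'E_P[fun w => fine (lebesgue_tuple n
                        (polytope (fun i => X i w) `&` eball r^-1))]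
  / fine (lebesgue_tuple n (eball r^-1 : set (n.-tuple R))).

(* Main.v *)
From HB Require Import structures.
Require Import Defs.
From mathcomp Require Import all_boot all_order all_algebra.
From mathcomp Require Import all_classical all_reals all_analysis.
From mathcomp Require Import measurable_realfun zify ring lra.

(** The idea. Write n = m.+1, let L = ln ((1 - r ^+ 2)^-1) and let cut x be the
probability that a single random point X violates <X, x> <= 1. By Tonelli and
independence, the expected volume is the integral of (1 - cut x) ^+ N over the
ball of radius r^-1 ([expected_volumeE]), so everything is decided by the size of
N times cut x.

The beta distribution is rotation invariant, hence cut x depends only on the
norm of x and is a tail of the law of the first coordinate
([beta_mass_halfspace]). Slicing the ball along that coordinate, each slice is a
rescaled copy of the ball of dimension m with the same weight, which shows that
the first coordinate has density proportional to (1 - t ^+ 2) `^ c on ]-1, 1[,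
where c = b + m / 2 ([beta_mass_marginal]). For large exponents c such an
integral is governed by the largest value of its integrand: up to factors
exp (o(c)), cut x is (1 - |x| ^- 2) `^ c, which on the boundary of the ball of
radius r^-1 is exp (- c * L) ([beta_distr_halfspace_le],
[beta_distr_halfspace_ge]).

Below the threshold, cut x is at most its value at the boundary, so that N * cut x
tends to 0 uniformly on the ball and the Bernoulli inequality
1 - N * cut x <= (1 - cut x) ^+ N shows that the ratio tends to 1
([subcritical_bound]). Above it, fix s slightly larger than r: the ball of radius
s^-1 occupies the vanishing proportion (r / s) ^+ n of the volume, while outside
of it N * cut x tends to infinity, so (1 - cut x) ^+ N <= (1 + N * cut x)^-1
tends to 0 ([supercritical_bound]). Since c > m / 2 - 1, both errors are bounded by
geometric sequences in n, uniformly in the exponent b.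

Three facts about Lebesgue measure on R^n, built as an iterated product, carry the
computation: the change of variables x |-> a x + y ([integral_axpy]), the
invariance under linear isometric involutions ([integral_isometry]), and the
finiteness and positivity of the volume of balls. *)

Set Implicit Arguments.
Unset Strict Implicit.
Unset Printing Implicit Defensive.

Import Order.TTheory GRing.Theory Num.Theory.
Import numFieldNormedType.Exports.

Local Open Scope classical_set_scope.
Local Open Scope ring_scope.

(** * Affine changes of variable on the line *)

Section affine_line.
Context {R : realType}.
Local Notation mu := (@lebesgue_measure R).

Lemma measurable_affine (a c : R) :
  measurable_fun [set: measurableTypeR R]
    ((fun x => a * x + c) : measurableTypeR R -> measurableTypeR R).
Proof.
by apply: measurable_funD => //; exact: measurable_funM.
Qed.

Lemma integral_affine_pos (g : R -> \bar R) (a c : R) : 0 < a ->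
  measurable_fun [set: R] g -> (forall x, (0 <= g x)%E) ->
  (\int[mu]_x g x = a%:E * \int[mu]_x g (a * x + c)%R)%E.
Proof.
move=> a0 mg g0.
pose phi : measurableTypeR R -> measurableTypeR R := fun x => a * x + c.
have mphi : measurable_fun setT phi by exact: measurable_affine.
pose phim : {mfun measurableTypeR R >-> measurableTypeR R} :=
  HB.pack phi (isMeasurableFun.Build _ _ _ _ _ mphi).
have a0' : 0 <= a by exact: ltW.
have := @ge0_integral_pushforward _ _ _ _ _ phi mphi mu setT g
  measurableT mg (fun y _ => g0 y).
rewrite preimage_setT => /(congr1 (fun z => a%:E * z)%E) <-.
have := @ge0_integral_mscale _ _ R (pushforward mu phim) _ measurableT
  (NngNum a0') g mg (fun y _ => g0 y).
move=> <-.
apply: eq_measure_integral => A mA _.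
apply: lebesgue_measure_unique => // _ [[p q]] _ <-.
rewrite /= /mscale /= /pushforward /=.
rewrite (_ : _ @^-1` _ = `](p - c) / a, (q - c) / a]%classic); last first.
  apply/seteqP; split => x /=; rewrite !in_itv /= /phi.
    by rewrite ltr_pdivrMr// ler_pdivlMr// (mulrC x) ltrBlDr lerBrDr.
  by rewrite ltr_pdivrMr// ler_pdivlMr// (mulrC x) ltrBlDr lerBrDr.
rewrite !lebesgue_measure_itv /= !lte_fin ltr_pM2r ?invr_gt0// ltrD2r.
case: ifPn => _; last by rewrite mule0.
by rewrite -!EFinB -EFinM; congr EFin; field; rewrite gt_eqF.
Qed.

Lemma integral_opp (g : R -> \bar R) :
  measurable_fun [set: R] g -> (forall x, (0 <= g x)%E) ->
  (\int[mu]_x g x = \int[mu]_x g (- x)%R)%E.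
Proof.
move=> mg g0.
have mN : measurable_fun setT (-%R : measurableTypeR R -> measurableTypeR R).
  exact: oppr_measurable.
have := @ge0_integral_pushforward _ _ _ _ _ _ mN mu setT g
  measurableT mg (fun y _ => g0 y).
rewrite preimage_setT => <-.
by apply: eq_measure_integral => A mA _; rewrite -[LHS]lebesgue_measureN.
Qed.

End affine_line.

(** * Lebesgue measure on R^n: iterated integrals and homotheties *)

Section tuple_space.
Context {R : realType}.
Implicit Types n : nat.
Local Notation mu := (@lebesgue_measure R).
Local Notation leb := (@lebesgue_tuple R).

(** The combination a x + c: the operations that matter here (translations,
homotheties, opposites, reflections) are all special cases of it. *)
Definition axpy n (a : R) (x c : n.-tuple R) : n.-tuple R :=
  [tuple a * tnth x i + tnth c i | i < n].

Lemma measurable_axpy d (T : measurableType d) n (a : R)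
    (f g : T -> n.-tuple R) :
  measurable_fun setT f -> measurable_fun setT g ->
  measurable_fun setT (fun x => axpy a (f x) (g x)).
Proof.
move=> /measurable_fun_tnthP mf /measurable_fun_tnthP mg.
apply/measurable_fun_tnthP => i.
rewrite [X in measurable_fun _ X](_ : _ =
  fun x => a * (tnth (f x) i) + tnth (g x) i); last first.
  by apply/funext => x /=; rewrite tnth_mktuple.
by apply: measurable_funD; [apply: measurable_funM => //; exact: mf|exact: mg].
Qed.

(** Restates [measurable_consp] with the Borel line on which
[lebesgue_measure] is declared: the two structures on R are convertible but not
identified by unification. *)
Lemma measurable_consp_borel n :
  measurable_fun setT (@consp R n : measurableTypeR R * n.-tuple R -> _).
Proof. exact: measurable_consp. Qed.

Lemma integral_lebesgue_succ n (f : n.+1.-tuple R -> \bar R) :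
  measurable_fun setT f -> (forall x, (0 <= f x)%E) ->
  (\int[leb n.+1]_x f x = \int[mu]_t \int[leb n]_v f (consp (t, v)))%E.
Proof.
move=> mf f0.
have := @ge0_integral_pushforward _ _ _ _ _ _ (@measurable_consp_borel n)
   (mu \x leb n)%E setT f measurableT mf (fun y _ => f0 y).
rewrite preimage_setT => ->.
rewrite (@fubini_tonelli1 _ _ _ _ _ mu (leb n) (f \o (@consp R n))) //;
  last by move=> x; exact: f0.
by apply: measurableT_comp => //; exact: measurable_consp_borel.
Qed.

Lemma measurable_integral_consp n (f : n.+1.-tuple R -> \bar R) :
  measurable_fun setT f -> (forall x, (0 <= f x)%E) ->
  measurable_fun [set: R] (fun t => \int[leb n]_v f (consp (t, v)))%E.
Proof.
move=> mf f0.
apply: (@measurable_fun_fubini_tonelli_F _ _ _ _ _ (leb n) (f \o (@consp R n)));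
  last by move=> x; exact: f0.
by apply: measurableT_comp => //; exact: measurable_consp_borel.
Qed.

Lemma consp_eta n (x : n.+1.-tuple R) :
  x = consp (tnth x ord0, [tuple of behead x]).
Proof. by apply: val_inj => /=; rewrite [in LHS](tuple_eta x). Qed.

Lemma axpy_consp n (a t c : R) (x y : n.-tuple R) :
  axpy a (consp (t, x)) (consp (c, y)) = consp (a * t + c, axpy a x y).
Proof.
apply: eq_from_tnth => i; rewrite tnth_mktuple.
by case: (unliftP ord0 i) => [j ->|->//]; rewrite !tnthS tnth_mktuple.
Qed.

(** One coordinate at a time: the first coordinate contributes a factor a by the
one-dimensional statement, the other ones a ^+ n by induction. *)
Lemma integral_axpy n (g : n.-tuple R -> \bar R) (a : R) (c : n.-tuple R) :
  0 < a -> measurable_fun setT g -> (forall x, (0 <= g x)%E) ->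
  (\int[leb n]_x g x = (a ^+ n)%:E * \int[leb n]_x g (axpy a x c))%E.
Proof.
move=> a0; elim: n g c => [|n IHn] g c mg g0.
  rewrite expr0 mul1e; apply: eq_integral => x _.
  by congr g; rewrite (tuple0 x); apply: eq_from_tnth => -[].
have mga b : measurable_fun setT (fun x => g (axpy a x b)).
  by apply: measurableT_comp => //; exact: measurable_axpy.
rewrite integral_lebesgue_succ// integral_lebesgue_succ//.
rewrite (consp_eta c); move: (tnth c _) [tuple of _] => c0 c1.
rewrite (@integral_affine_pos _ _ a c0) //; last 2 first.
- exact: measurable_integral_consp.
- by move=> t; exact: integral_ge0.
rewrite exprS EFinM -muleA; congr (_ * _)%E.
rewrite -ge0_integralZl//; last 3 first.
- exact: (@measurable_integral_consp _ (fun x => g (axpy a x (consp (c0, c1))))).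
- by move=> t _; exact: integral_ge0.
- by rewrite lee_fin exprn_ge0// ltW.
apply: eq_integral => t _.
under [in RHS]eq_integral do rewrite axpy_consp.
apply: (IHn (fun v => g (consp (a * t + c0, v)))) => //.
apply: measurableT_comp => //.
by apply: (measurableT_comp (@measurable_consp R n)); exact: measurable_pair1.
Qed.

Lemma integral_translate n (g : n.-tuple R -> \bar R) (c : n.-tuple R) :
  measurable_fun setT g -> (forall x, (0 <= g x)%E) ->
  (\int[leb n]_x g x = \int[leb n]_x g (axpy 1 x c))%E.
Proof. by move=> mg g0; rewrite (@integral_axpy _ _ 1 c)// expr1n mul1e. Qed.

End tuple_space.

(** * Balls and linear isometries *)

Section isometry.
Context {R : realType}.
Implicit Types n : nat.
Local Notation mu := (@lebesgue_measure R).
Local Notation leb := (@lebesgue_tuple R).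

Lemma dotpC n (x y : n.-tuple R) : dotp x y = dotp y x.
Proof. by apply: eq_bigr => i _; rewrite mulrC. Qed.

Lemma dotp_axpyl n (a : R) (x y z : n.-tuple R) :
  dotp (axpy a x y) z = a * dotp x z + dotp y z.
Proof.
rewrite /dotp mulr_sumr -big_split /=; apply: eq_bigr => i _.
by rewrite tnth_mktuple mulrDl mulrA.
Qed.

Lemma dotp_axpyr n (a : R) (x y z : n.-tuple R) :
  dotp z (axpy a x y) = a * dotp z x + dotp z y.
Proof. by rewrite dotpC dotp_axpyl !(dotpC z). Qed.

Lemma dotp_ge0 n (x : n.-tuple R) : 0 <= dotp x x.
Proof. by apply: sumr_ge0 => i _; rewrite -expr2 sqr_ge0. Qed.

Lemma dotp_eq0 n (x y : n.-tuple R) : dotp x x = 0 -> dotp y x = 0.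
Proof.
move=> /eqP; rewrite psumr_eq0 => [/allP x0|i _]; last by rewrite -expr2 sqr_ge0.
apply: big1 => i _; have := x0 i (mem_index_enum i).
by rewrite /= -expr2 sqrf_eq0 => /eqP ->; rewrite mulr0.
Qed.

Lemma enorm_ge0 n (x : n.-tuple R) : 0 <= enorm x.
Proof. exact: sqrtr_ge0. Qed.

Lemma sqr_enorm n (x : n.-tuple R) : enorm x ^+ 2 = dotp x x.
Proof. by rewrite sqr_sqrtr ?dotp_ge0. Qed.

Lemma enorm_le n (x : n.-tuple R) (r : R) : 0 <= r ->
  (enorm x <= r) = (dotp x x <= r ^+ 2).
Proof.
by move=> r0; rewrite -sqr_enorm ler_sqr// nnegrE ?enorm_ge0.
Qed.

Lemma measurable_box n (A : 'I_n -> set R) : (forall i, measurable (A i)) ->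
  measurable [set x : n.-tuple R | forall i, A i (tnth x i)].
Proof.
move=> mA.
rewrite (_ : [set _ | _] = \bigcap_(i in [set: 'I_n])
    ((fun x => tnth x i) @^-1` (A i))).
  apply: fin_bigcap_measurable => // i _.
  by rewrite -[X in measurable X]setTI; exact: measurable_tnth.
by apply/seteqP; split => x /=; [move=> h i _; exact: h|move=> h i; exact: h].
Qed.

Lemma sqr_tnth_le n (x : n.-tuple R) i : tnth x i ^+ 2 <= dotp x x.
Proof.
rewrite /dotp (bigD1 i)//= -expr2 lerDl.
by apply: sumr_ge0 => j _; rewrite -expr2 sqr_ge0.
Qed.

(** The ball is contained in the cube of half-side r. *)
Lemma eball_lty n (r : R) : (leb n (eball r) < +oo)%E.
Proof.
pose B := fun _ : 'I_n => `[(- r)%R, r]%classic.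
have mB i : measurable (B i) by exact: measurable_itv.
apply: (@le_lt_trans _ _ (leb n [set x | forall i, B i (tnth x i)])).
  apply: le_measure; rewrite ?inE; [exact: measurable_eball|exact: measurable_box|].
  move=> x xr i; have r0 : 0 <= r := le_trans (enorm_ge0 x) xr.
  move: xr; rewrite /eball /= enorm_le// => xr.
  rewrite /B /= in_itv /= -ler_norml -(ger0_norm r0) -ler_sqr ?nnegrE//.
  by rewrite !real_normK ?num_real// (le_trans (sqr_tnth_le _ _)).
rewrite (@lebesgue_tuple_box _ _ B)// ltey_eq.
apply/orP; left; elim/big_ind : _ => //; first by move=> x y; exact: fin_numM.
by move=> i _; rewrite lebesgue_measure_itv /=; case: ifP.
Qed.

(** The ball contains the cube of half-side r / n.+1, where n.+1 instead of the
square root of n suffices and also covers dimension 0. *)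
Lemma eball_gt0 n (r : R) : 0 < r -> (0 < leb n (eball r))%E.
Proof.
move=> r0; pose s := r / n.+1%:R.
have s0 : 0 < s by rewrite divr_gt0.
pose B := fun _ : 'I_n => `[(- s)%R, s]%classic.
have mB i : measurable (B i) by exact: measurable_itv.
apply: (@lt_le_trans _ _ (leb n [set x | forall i, B i (tnth x i)])).
  rewrite (@lebesgue_tuple_box _ _ B)//.
  elim/big_ind : _ => //; first by move=> x y; exact: mule_gt0.
  move=> i _; rewrite lebesgue_measure_itv /= lte_fin gtrN//.
  by rewrite -EFinB lte_fin opprK addr_gt0.
apply: le_measure; rewrite ?inE; [exact: measurable_box|exact: measurable_eball|].
move=> x /= xs; rewrite /eball /= enorm_le; last exact: ltW.
apply: (@le_trans _ _ (\sum_(i < n) s ^+ 2)).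
  apply: ler_sum => i _; have := xs i.
  rewrite /B /= in_itv /= -ler_norml -expr2 => xis.
  by rewrite -[tnth x i ^+ 2]real_normK ?num_real// ler_sqr ?nnegrE// ltW.
rewrite sumr_const card_ord -mulr_natr /s expr_div_n.
rewrite mulrAC ler_pdivrMr ?exprn_gt0// ler_wpM2l ?sqr_ge0//.
by rewrite -natrX ler_nat; nia.
Qed.

(** The standard uniqueness argument for translation-invariant measures,
specialised to the image of Lebesgue measure under T. With f the indicator of the
unit ball, the double integral of f x * g (y + T x) equals
(\int f) * (\int g) when y is integrated first. When x is integrated first, the
substitution x |-> x - T y turns the integrand into f (x - T y) * g (T x); since
|x - T y| = |y - T x|, integrating y back first gives (\int f) * (\int g \o T).
The volume of the ball is positive and finite, hence can be cancelled. *)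
Lemma integral_isometry n (T : n.-tuple R -> n.-tuple R)
    (g : n.-tuple R -> \bar R) :
  measurable_fun setT T -> involutive T ->
  (forall a x y, T (axpy a x y) = axpy a (T x) (T y)) ->
  (forall x, enorm (T x) = enorm x) ->
  measurable_fun setT g -> (forall x, (0 <= g x)%E) ->
  (\int[leb n]_x g x = \int[leb n]_x g (T x))%E.
Proof.
move=> mT TK TD Tnorm mg g0.
pose z0 : n.-tuple R := [tuple 0 | i < n].
pose opp (y : n.-tuple R) := axpy (-1) y z0.
have T0 : T z0 = z0.
  have z0E x : axpy (-1) x x = z0.
    by apply: eq_from_tnth => i; rewrite !tnth_mktuple mulN1r addNr.
  by rewrite -[in LHS](z0E z0) TD z0E.
have mopp : measurable_fun setT opp by exact: measurable_axpy.
pose f (x : n.-tuple R) : \bar R := (\1_(eball 1) x)%:E.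
have mf : measurable_fun setT f.
  by apply/measurable_EFinP; apply: measurable_indic; exact: measurable_eball.
have f0 x : (0 <= f x)%E by rewrite lee_fin.
have fnorm x y : enorm x = enorm y -> f x = f y.
  by move=> xy; congr EFin; rewrite !indicE; congr ((_ : bool)%:R);
    by apply/idP/idP; rewrite !inE /eball /= xy.
have If : (\int[leb n]_x f x = leb n (eball 1))%E.
  by rewrite integral_indic ?setIT//; exact: measurable_eball.
pose h (p : n.-tuple R * n.-tuple R) : \bar R := (f p.1 * g (axpy 1 p.2 (T p.1)))%E.
have mh : measurable_fun setT h.
  apply: emeasurable_funM; first exact: measurableT_comp.
  apply: measurableT_comp => //; apply: measurable_axpy => //.
  exact: measurableT_comp.
have h0 p : (0 <= h p)%E by rewrite mule_ge0.
have mgT : measurable_fun setT (g \o T) by exact: measurableT_comp.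
have := @fubini_tonelli _ _ _ _ _ (leb n) (leb n) h mh h0.
rewrite (_ : \int[leb n]_x \int[leb n]_y h (x, y) =
    leb n (eball 1) * \int[leb n]_x g x)%E; last first.
  rewrite -If -ge0_integralZr//; last exact: integral_ge0.
  apply: eq_integral => x _; rewrite /h /= ge0_integralZl//; last first.
    by apply: measurableT_comp => //; exact: measurable_axpy.
  by rewrite -(@integral_translate _ _ g).
rewrite (_ : (\int[leb n]_y \int[leb n]_x h (x, y))%E =
  (\int[leb n]_y \int[leb n]_x (f (axpy 1 x (opp (T y))) * g (T x)))%E); last first.
  apply: eq_integral => y _.
  rewrite (@integral_translate _ _ (fun x => h (x, y)) (opp (T y))) //; last first.
    by apply: measurableT_comp => //; exact: measurable_pair2.
  apply: eq_integral => x _; rewrite /h /=; congr (_ * g _)%E.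
  apply: eq_from_tnth => i.
  by rewrite !TD TK T0 !tnth_mktuple; ring.
rewrite -(@fubini_tonelli _ _ _ _ _ (leb n) (leb n)
  (fun p => f (axpy 1 p.1 (opp (T p.2))) * g (T p.1))%E); last 2 first.
- apply: emeasurable_funM; last exact: (measurableT_comp mgT).
  apply: measurableT_comp => //; apply: measurable_axpy => //.
  by apply: measurableT_comp => //; exact: measurableT_comp.
- by move=> p; rewrite mule_ge0.
rewrite (_ : \int[leb n]_x \int[leb n]_y (f (axpy 1 x (opp (T y))) * g (T x)) =
    leb n (eball 1) * \int[leb n]_x g (T x))%E; last first.
  rewrite -If -ge0_integralZl//; last exact: integral_ge0.
  apply: eq_integral => x _; rewrite ge0_integralZr//; last first.
    apply: measurableT_comp => //; apply: measurable_axpy => //.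
    exact: measurableT_comp.
  congr (_ * _)%E; rewrite [RHS](@integral_translate _ _ f (opp (T x)))//.
  (* Both points have the same norm because T (x - T y) = T x - y. *)
  apply: eq_integral => y _; apply: fnorm.
  have dz z : dotp z0 z = 0.
    by apply: big1 => i _; rewrite tnth_mktuple mul0r.
  rewrite -[LHS]Tnorm !TD TK T0 /enorm !(dotp_axpyl, dotp_axpyr) !(dotpC _ z0) !dz.
  by rewrite (dotpC y); congr (Num.sqrt _); ring.
have := eball_lty n 1; have := @eball_gt0 n 1 ltr01.
move: (leb n (eball 1)) => [v||]// v0 _ /(congr1 (fun z => (v^-1)%:E * z)%E).
by rewrite !muleA -EFinM mulVf ?mul1e// gt_eqF.
Qed.

End isometry.

(** * The reflection exchanging a point and a point of the first axis *)

Section reflection.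
Context {R : realType}.
Implicit Types n : nat.
Local Notation mu := (@lebesgue_measure R).
Local Notation leb := (@lebesgue_tuple R).

(** The Householder reflection in the hyperplane orthogonal to w; it is the
identity when w = 0, since then the quotient is 0. *)
Definition reflect_along n (w X : n.-tuple R) : n.-tuple R :=
  axpy (- (2 * dotp X w / dotp w w)) w X.

Lemma measurable_dotp_fun d (T : measurableType d) n (f g : T -> n.-tuple R) :
  measurable_fun setT f -> measurable_fun setT g ->
  measurable_fun setT (fun x => dotp (f x) (g x)).
Proof.
move=> /measurable_fun_tnthP mf /measurable_fun_tnthP mg.
by apply: measurable_sum => i; apply: measurable_funM; [exact: mf|exact: mg].
Qed.

Lemma measurable_reflect_along n (w : n.-tuple R) :
  measurable_fun setT (reflect_along w).
Proof.
apply/measurable_fun_tnthP => i.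
rewrite [X in measurable_fun _ X](_ : _ =
  fun X => (- (2 * dotp X w / dotp w w)) * tnth w i + tnth X i); last first.
  by apply/funext => X /=; rewrite tnth_mktuple.
apply: measurable_funD; last exact: measurable_tnth.
apply: measurable_funM => //; apply: measurableT_comp => //.
apply: measurable_funM => //; apply: measurable_funM => //.
exact: measurable_dotp.
Qed.

Lemma dotp_reflect_along n (w X Y : n.-tuple R) :
  dotp (reflect_along w X) Y = dotp X Y - 2 * dotp X w / dotp w w * dotp w Y.
Proof. by rewrite dotp_axpyl; ring. Qed.

Lemma reflect_alongK n (w : n.-tuple R) : involutive (reflect_along w).
Proof.
move=> X; have [w0|w0] := eqVneq (dotp w w) 0.
  by apply: eq_from_tnth => i; rewrite !tnth_mktuple w0 invr0; ring.
apply: eq_from_tnth => i; rewrite {1}/reflect_along tnth_mktuple.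
rewrite dotp_reflect_along [tnth (reflect_along _ _) _]tnth_mktuple.
by field.
Qed.

Lemma reflect_along_axpy n (w : n.-tuple R) (a : R) (X Y : n.-tuple R) :
  reflect_along w (axpy a X Y) = axpy a (reflect_along w X) (reflect_along w Y).
Proof.
apply: eq_from_tnth => i; rewrite !tnth_mktuple dotp_axpyl.
have [->|w0] := eqVneq (dotp w w) 0; last by field.
by rewrite invr0; ring.
Qed.

Lemma enorm_reflect_along n (w X : n.-tuple R) :
  enorm (reflect_along w X) = enorm X.
Proof.
rewrite /enorm dotp_reflect_along (dotpC X) (dotpC w (reflect_along w X)).
rewrite !dotp_reflect_along.
have [->|w0] := eqVneq (dotp w w) 0; last first.
  by congr Num.sqrt; rewrite (dotpC w); field.
by rewrite invr0 !(mulr0, mul0r, subr0).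
Qed.

Lemma dotp_consp n (a b : R) (v w : n.-tuple R) :
  dotp (consp (a, v)) (consp (b, w)) = a * b + dotp v w.
Proof.
by rewrite /dotp big_ord_recl; congr (_ + _); apply: eq_bigr => i _; rewrite !tnthS.
Qed.

Lemma dotp_zero n (x : n.-tuple R) : dotp x [tuple 0 | i < n] = 0.
Proof. by apply: big1 => i _; rewrite tnth_mktuple mulr0. Qed.

(** The reflection along w = x - |x| e exchanges x and |x| e, where e is the first
unit vector. Reflections are self-adjoint, so <T X, x> = <X, T x> = |x| X_0. *)
Lemma exists_reflection_to_axis n (x : n.+1.-tuple R) :
  exists T : n.+1.-tuple R -> n.+1.-tuple R,
    [/\ measurable_fun setT T, involutive T,
      forall a X Y, T (axpy a X Y) = axpy a (T X) (T Y),
      forall X, enorm (T X) = enorm X &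
      forall X, dotp (T X) x = enorm x * tnth X ord0].
Proof.
pose e := consp (enorm x, [tuple 0 | i < n]).
have dote X : dotp X e = enorm x * tnth X ord0.
  by rewrite {1}(consp_eta X) dotp_consp dotp_zero addr0 mulrC.
pose w := axpy (-1) e x.
exists (reflect_along w); split.
- exact: measurable_reflect_along.
- exact: reflect_alongK.
- exact: reflect_along_axpy.
- exact: enorm_reflect_along.
move=> X; rewrite -dote dotp_reflect_along.
have [w0|w0] := eqVneq (dotp w w) 0.
  have := dotp_eq0 X w0; rewrite dotp_axpyr mulN1r => /eqP.
  by rewrite w0 invr0 mulr0 mul0r subr0 addrC subr_eq0 => /eqP.
(* This is where the two exchanged points are required to have the same norm. *)
have wx : dotp w w = 2 * dotp w x.
  rewrite /w !(dotp_axpyl, dotp_axpyr).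
  have ee : dotp e e = dotp x x by rewrite dote /e /= -expr2 sqr_enorm.
  by rewrite ee (dotpC e x); ring.
rewrite wx in w0 *.
have wx0 : dotp w x != 0 by apply: contraNneq w0 => ->; rewrite mulr0.
have -> : 2 * dotp X w / (2 * dotp w x) * dotp w x = dotp X w by field.
by rewrite dotp_axpyr; ring.
Qed.

End reflection.

(** * The first marginal of the beta distribution *)

Section marginal.
Context {R : realType}.
Implicit Types (n : nat) (b : R).
Local Notation mu := (@lebesgue_measure R).
Local Notation leb := (@lebesgue_tuple R).

(** The density of the beta mass of A with respect to Lebesgue measure on the
whole space. *)
Definition beta_weight n b (A : set (n.-tuple R)) : n.-tuple R -> \bar R :=
  (EFin \o beta_density b) \_ (A `&` eball 1).

Lemma beta_massE n b (A : set (n.-tuple R)) :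
  beta_mass b A = (\int[leb n]_x beta_weight b A x)%E.
Proof. by rewrite /beta_mass integral_mkcond. Qed.

Lemma beta_weight_ge0 n b (A : set (n.-tuple R)) x : (0 <= beta_weight b A x)%E.
Proof. by rewrite /beta_weight patchE; case: ifP => // _; rewrite lee_fin powR_ge0. Qed.

Lemma measurable_beta_weight n b (A : set (n.-tuple R)) : measurable A ->
  measurable_fun setT (beta_weight b A).
Proof.
move=> mA; apply/(measurable_restrictT _ _).1.
  by apply: measurableI => //; exact: measurable_eball.
by apply/measurable_funTS/measurable_EFinP; exact: measurable_beta_density.
Qed.

Lemma measurable_halfspace n (x : n.-tuple R) :
  measurable [set X : n.-tuple R | 1 < dotp X x].
Proof.
rewrite (_ : [set _ | _] = (fun X => dotp X x) @^-1` `]1, +oo[%classic).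
  by rewrite -[X in measurable X]setTI; exact: measurable_dotp.
by apply/seteqP; split => X /=; rewrite in_itv /= andbT.
Qed.

Lemma measurable_tnth_preimage n (A : set R) (i : 'I_n) : measurable A ->
  measurable [set X : n.-tuple R | A (tnth X i)].
Proof.
by move=> mA; rewrite -[X in measurable X]setTI; exact: measurable_tnth.
Qed.

(** The beta weight only depends on the norm, so the isometry of
[exists_reflection_to_axis] reduces any half-space to one orthogonal to the first
axis. *)
Lemma beta_mass_halfspace n b (x : n.+1.-tuple R) :
  beta_mass b [set X : n.+1.-tuple R | 1 < dotp X x] =
  beta_mass b [set X : n.+1.-tuple R | 1 < enorm x * tnth X ord0].
Proof.
have [T [mT TK TL Tnorm Tx]] := exists_reflection_to_axis x.
rewrite !beta_massE (integral_isometry mT TK TL Tnorm).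
- apply: eq_integral => X _; rewrite /beta_weight !patchE.
  rewrite /beta_density /= Tnorm; congr (if _ then _ else _).
  by apply/idP/idP; rewrite !inE /eball /= Tx Tnorm.
- by apply: measurable_beta_weight; exact: measurable_halfspace.
- by move=> X; exact: beta_weight_ge0.
Qed.

(** The mass of A for the unnormalised one-dimensional beta (symmetric Jacobi)
weight. The end points, at which the slices of the ball degenerate to points, are left
out. *)
Definition jacobi_mass (c : R) (A : set R) : \bar R :=
  (\int[mu]_(t in A `&` `](-1)%R, 1%R[%classic) ((1 - t ^+ 2) `^ c)%:E)%E.

(** The slice of the unit ball at height t is a ball of radius s with
s ^+ 2 = 1 - t ^+ 2. Rescaling it to the unit ball multiplies Lebesgue measure by
s ^+ n and the density by s ^+ 2 `^ b, whence the exponent b + n / 2. *)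
Lemma beta_mass_slice n b (t : R) : -1 < t < 1 ->
  (\int[leb n]_v beta_weight b setT (consp (t, v)) =
   ((1 - t ^+ 2) `^ (b + n%:R / 2))%:E * beta_mass b [set: n.-tuple R])%E.
Proof.
move=> t1; pose q := 1 - t ^+ 2.
have q0 : 0 < q by rewrite subr_gt0 -real_normK ?num_real// expr_lt1// ltr_norml.
pose s := Num.sqrt q.
have s0 : 0 < s by rewrite sqrtr_gt0.
have s2 : s ^+ 2 = q by rewrite sqr_sqrtr// ltW.
have mw : measurable_fun setT (fun v : n.-tuple R => beta_weight b setT (consp (t, v))).
  apply: measurableT_comp; first exact: measurable_beta_weight.
  by apply: (measurableT_comp (@measurable_consp R n)); exact: measurable_pair1.
rewrite (@integral_axpy _ _ _ s [tuple 0 | i < n]) //; last first.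
  by move=> v; exact: beta_weight_ge0.
have weightE (v : n.-tuple R) :
    beta_weight b setT (consp (t, axpy s v [tuple 0 | i < n])) =
    ((q `^ b)%:E * beta_weight b setT v)%E.
  have nE : enorm (consp (t, axpy s v [tuple 0 | i < n])) ^+ 2 =
      t ^+ 2 + q * enorm v ^+ 2.
    rewrite !sqr_enorm dotp_consp !(dotp_axpyl, dotp_axpyr) (dotpC _ v).
    by rewrite !dotp_zero -s2; ring.
  have inE' : (consp (t, axpy s v [tuple 0 | i < n]) \in setT `&` eball 1) =
      (v \in setT `&` eball 1).
    have ballE m (y : m.-tuple R) : (y \in setT `&` eball 1) = (enorm y ^+ 2 <= 1).
      rewrite sqr_enorm -[X in _ <= X](expr1n _ 2) -enorm_le//.
      by apply/idP/idP; rewrite inE /eball /=; first by case.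
    rewrite !ballE nE -[1 in LHS](subrK (t ^+ 2)) -/q addrC lerD2r.
    by rewrite -[X in _ <= X]mulr1 ler_pM2l.
  rewrite /beta_weight !patchE inE'; case: ifPn; last by rewrite mule0.
  rewrite inE /eball /= => -[_ v1].
  rewrite /beta_density nE -EFinM -powRM.
  - by congr (_ `^ _)%:E; rewrite /q; ring.
  - exact: ltW.
  - by rewrite subr_ge0 expr_le1// enorm_ge0.
under eq_integral do rewrite weightE.
rewrite ge0_integralZl//; last 3 first.
- exact: measurable_beta_weight.
- by move=> v _; exact: beta_weight_ge0.
- by rewrite lee_fin powR_ge0.
rewrite muleA -EFinM beta_massE; congr (_%:E * _)%E.
rewrite /s -powR12_sqrt ?ltW// -powR_mulrn ?powR_ge0// -powRrM -powRD; last first.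
  by rewrite (gt_eqF q0) implybT.
by congr (_ `^ _); ring.
Qed.

(** Integrate [beta_mass_slice] over the height. The two sides agree except at the
heights -1 and 1, where the slice is a point. *)
Lemma beta_mass_marginal n b (A : set R) : measurable A ->
  beta_mass b [set X : n.+1.-tuple R | A (tnth X ord0)] =
  (beta_mass b [set: n.-tuple R] * jacobi_mass (b + n%:R / 2) A)%E.
Proof.
move=> mA; have mB := measurable_tnth_preimage (@ord0 n) mA.
rewrite beta_massE integral_lebesgue_succ; last 2 first.
- exact: measurable_beta_weight.
- by move=> x; exact: beta_weight_ge0.
have mI : measurable (A `&` `]-1, 1[%classic) by exact: measurableI.
have mpow : measurable_fun (A `&` `]-1, 1[%classic)
    (fun t : R => ((1 - t ^+ 2) `^ (b + n%:R / 2))%:E).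
  apply/measurable_funTS/measurable_EFinP.
  apply: (measurableT_comp (measurable_powR _)).
  by apply: measurable_funB => //; exact: measurable_funX.
rewrite /jacobi_mass -ge0_integralZl//; last first.
  by move=> t _; rewrite lee_fin powR_ge0.
rewrite [RHS]integral_mkcond; apply: ge0_ae_eq_integral => //.
- apply: measurable_integral_consp; first exact: measurable_beta_weight.
  by move=> x; exact: beta_weight_ge0.
- apply/(measurable_restrictT _ _).1 => //; exact: measurable_funeM.
- by move=> t _; apply: integral_ge0 => v _; exact: beta_weight_ge0.
- move=> t _; rewrite patchE; case: ifP => // _.
  by rewrite mule_ge0// lee_fin powR_ge0.
exists [set -1; 1]; split => //; first exact: measurableU.
  apply: countable_lebesgue_measure0; apply: finite_set_countable.
  by rewrite finite_setU.
move=> t /=; apply: contra_notP => /not_orP[/eqP tN1 /eqP t1] _.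
rewrite patchE; case: ifPn => [|tAI].
  rewrite inE => -[At]; rewrite /= in_itv /= => t11.
  rewrite muleC -beta_mass_slice//; apply: eq_integral => v _.
  rewrite /beta_weight !patchE; congr (if _ then _ else _).
  by apply/idP/idP; rewrite !inE /= => -[].
apply: integral0_eq => v _; rewrite /beta_weight patchE ifF//.
apply/negbTE; apply: contra tAI; rewrite !inE => -[/= At].
rewrite /eball /= enorm_le// expr1n dotp_consp => tv1; split=> //.
rewrite in_itv /= !lt_neqAle eq_sym tN1 t1 /= -ler_norml.
rewrite -(@ler_pXn2r _ 2) ?nnegrE// real_normK ?num_real// expr1n.
by apply: le_trans tv1; rewrite -expr2 lerDl dotp_ge0.
Qed.

End marginal.

(** * One-dimensional estimates *)

Section jacobi.
Context {R : realType}.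
Implicit Types (c r : R).
Local Notation mu := (@lebesgue_measure R).

Lemma continuous_powR_gt0 c (x : R) : 0 < x -> {for x, continuous (fun s : R => s `^ c)}.
Proof.
move=> x0; apply: differentiable_continuous; apply/derivable1_diffP.
by apply: derivable_powR; rewrite in_itv /= x0.
Qed.

Lemma integral_powR_itvcc c (a : R) : -1 < c -> 0 < a -> a < 2 ->
  (\int[mu]_(s in `[a, 2%R]) (s `^ c)%:E <= (2 `^ (c + 1) / (c + 1))%:E)%E.
Proof.
move=> c1 a0 a2; pose F (s : R) := s `^ (c + 1) / (c + 1).
have c10 : 0 < c + 1 by lra.
have gt0 x : x \in `]a, 2[ -> 0 < x.
  by rewrite in_itv /= => /andP[ax _]; exact: lt_trans ax.
have cF x : 0 < x -> {for x, continuous F}.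
  by move=> x0; apply: cvgM; [exact: continuous_powR_gt0|exact: cvg_cst].
rewrite (@continuous_FTC2 _ _ F)//.
- rewrite /F -EFinB lee_fin gerBl divr_ge0 ?powR_ge0//; exact: ltW.
- apply: derivable_within_continuous => x; rewrite in_itv /= => /andP[ax _].
  by apply: derivable_powR; rewrite in_itv /= andbT; exact: lt_le_trans ax.
- split.
  + move=> x /gt0 x0; apply: derivableM => //.
    by apply: derivable_powR; rewrite in_itv /= x0.
  + by apply: cvg_at_right_filter; exact: cF.
  + by apply: cvg_at_left_filter; apply: cF.
- move=> x /gt0 x0; rewrite derive1E.
  have dpow := is_derive1_powR (c + 1) x0.
  rewrite /F deriveM // derive_cst derive_val scaler0 add0r /GRing.scale /=.
  by rewrite addrK; field; rewrite gt_eqF.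
Qed.

(** Exhaust ]0, 2[ by compact intervals, on which [integral_powR_itvcc] gives a
uniform bound. *)
Lemma integral_powR_lty c : -1 < c ->
  (\int[mu]_(s in `]0%R, 2%R[) (s `^ c)%:E < +oo)%E.
Proof.
move=> c1; pose F k : set R := `[k.+2%:R^-1, 2]%classic.
apply: (@le_lt_trans _ _ (2 `^ (c + 1) / (c + 1))%:E); last exact: ltry.
have mpow D : measurable_fun D (fun s : R => (s `^ c)%:E).
  by apply/measurable_funTS/measurable_EFinP; exact: measurable_powR.
have ndF : nondecreasing_seq F.
  move=> i j ij; apply/subsetPset => x; rewrite /F /= !in_itv /= => /andP[ix ->].
  by rewrite andbT (le_trans _ ix)// lef_pV2 ?posrE// ler_nat.
apply: (@le_trans _ _ (\int[mu]_(s in \bigcup_k F k) (s `^ c)%:E)%E).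
  apply: ge0_subset_integral => //.
  - by apply: bigcup_measurable => k _; exact: measurable_itv.
  - exact: mpow.
  - by move=> s _; rewrite lee_fin powR_ge0.
  - move=> s; rewrite /= in_itv /= => /andP[s0 s2].
    exists (Num.trunc s^-1) => //; rewrite /F /= in_itv /= (ltW s2) andbT.
    rewrite -[X in _ <= X]invrK lef_pV2 ?posrE ?invr_gt0//.
    by rewrite (le_trans (ltW (truncnS_gt _)))// ler_nat.
have := @ge0_nondecreasing_set_cvg_integral _ (measurableTypeR R) R F
  (fun s => (s `^ c)%:E) mu ndF.
move=> /(_ (fun=> measurable_itv _) (fun k => mpow (F k))).
move=> /(_ (fun k s _ => powR_ge0 s c)).
move=> /cvge_to_le; apply; near=> k; apply: integral_powR_itvcc => //.
by rewrite (le_lt_trans (_ : _ <= 1)) ?ltr1n// invf_le1 ?ler1n ?ltr0n.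
Unshelve. all: end_near.
Qed.


Lemma measurable_jacobi c (D : set R) :
  measurable_fun D (fun t : R => ((1 - t ^+ 2) `^ c)%:E).
Proof.
apply/measurable_funTS/measurable_EFinP.
apply: (measurableT_comp (measurable_powR _)).
by apply: measurable_funB => //; exact: measurable_funX.
Qed.

Lemma onemsqr_itv (t : R) : -1 < t < 1 -> 0 < 1 - t ^+ 2 <= 1.
Proof.
move=> t1; rewrite lerBlDr lerDl sqr_ge0 andbT subr_gt0.
by rewrite -real_normK ?num_real// expr_lt1// ltr_norml.
Qed.

Lemma jacobi_mass_ge0 c (A : set R) : (0 <= jacobi_mass c A)%E.
Proof. by apply: integral_ge0 => t _; rewrite lee_fin powR_ge0. Qed.

Lemma jacobi_mass_subset c (A B : set R) : measurable A -> measurable B ->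
  A `<=` B -> (jacobi_mass c A <= jacobi_mass c B)%E.
Proof.
move=> mA mB AB; apply: ge0_subset_integral => //.
- exact: measurableI.
- exact: measurableI.
- exact: measurable_jacobi.
- by move=> t _; rewrite lee_fin powR_ge0.
- exact: setSI.
Qed.

Lemma jacobi_mass_anti c c' (A : set R) : measurable A -> c <= c' ->
  (jacobi_mass c' A <= jacobi_mass c A)%E.
Proof.
move=> mA cc'; apply: ge0_le_integral => //.
- exact: measurableI.
- by move=> t _; rewrite lee_fin powR_ge0.
- exact: measurable_jacobi.
- exact: measurable_jacobi.
- move=> t [_]; rewrite /= in_itv /= => /onemsqr_itv t1.
  by rewrite lee_fin ger_powR.
Qed.

Lemma jacobi_mass0 (A : set R) : measurable A ->
  jacobi_mass 0 A = mu (A `&` `]-1, 1[).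
Proof.
move=> mA; rewrite /jacobi_mass; under eq_integral do rewrite powRr0.
by rewrite integral_cst ?mul1e//; exact: measurableI.
Qed.

Lemma jacobi_massT_le2 c : 0 <= c -> (jacobi_mass c setT <= 2%:E)%E.
Proof.
move=> c0; apply: (le_trans (jacobi_mass_anti _ c0)) => //.
rewrite jacobi_mass0// setTI lebesgue_measure_itv /= lte_fin gtrN//.
by rewrite -EFinB lee_fin; lra.
Qed.

Lemma jacobi_mass_ge c (p q : R) (A : set R) : 0 <= c -> 0 <= p -> p <= q ->
  q < 1 -> measurable A -> `]p, q] `<=` A ->
  (((q - p) * (1 - q ^+ 2) `^ c)%:E <= jacobi_mass c A)%E.
Proof.
move=> c0 p0 pq q1 mA pqA.
apply: (@le_trans _ _ (jacobi_mass c `]p, q])); last first.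
  by apply: jacobi_mass_subset.
have -> : jacobi_mass c `]p, q] =
    (\int[mu]_(t in `]p, q]) ((1 - t ^+ 2) `^ c)%:E)%E.
  rewrite /jacobi_mass; congr integral; apply/setIidl => t /=.
  rewrite !in_itv /= => /andP[pt tq]; apply/andP; split; last exact: le_lt_trans q1.
  by rewrite (lt_le_trans _ (le_trans p0 (ltW pt)))// ltrN10.
apply: (@le_trans _ _ (\int[mu]_(t in `]p, q]) ((1 - q ^+ 2) `^ c)%:E)%E).
  rewrite integral_cst//= lebesgue_measure_itv /= lte_fin.
  case: ltP => [_|qp]; first by rewrite -EFinB -EFinM mulrC.
  by rewrite mule0 (_ : q - p = 0) ?mul0r//; apply/eqP; rewrite subr_eq0 eq_le qp pq.
apply: ge0_le_integral => //.
- by move=> t _; rewrite lee_fin powR_ge0.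
- exact: measurable_jacobi.
- move=> t; rewrite /= in_itv /= => /andP[pt tq].
  have t0 : 0 <= t := le_trans p0 (ltW pt).
  have q0 : 0 <= q := le_trans p0 pq.
  rewrite lee_fin ge0_ler_powR// ?nnegrE.
  + by rewrite subr_ge0 expr_le1// ltW.
  + by rewrite subr_ge0 expr_le1// (le_trans tq)// ltW.
  + by rewrite lerD2l lerN2 ler_sqr.
Qed.

Lemma jacobi_mass_le c r (A : set R) : 0 <= c -> 0 <= r -> r < 1 ->
  measurable A -> A `<=` `]r, +oo[ ->
  (jacobi_mass c A <= ((1 - r ^+ 2) `^ c)%:E)%E.
Proof.
move=> c0 r0 r1 mA Ar.
have mI : measurable (A `&` `]-1, 1[%classic) by exact: measurableI.
apply: (@le_trans _ _ (\int[mu]_(t in A `&` `](-1)%R, 1%R[%classic)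
    ((1 - r ^+ 2) `^ c)%:E)%E).
  apply: ge0_le_integral => //.
  - by move=> t _; rewrite lee_fin powR_ge0.
  - exact: measurable_jacobi.
  - move=> t [/Ar + /=]; rewrite /= !in_itv /= andbT => rt /andP[_ t1].
    have t0 : 0 <= t := le_trans r0 (ltW rt).
    rewrite lee_fin ge0_ler_powR// ?nnegrE.
    + by rewrite subr_ge0 expr_le1// ltW.
    + by rewrite subr_ge0 expr_le1// ltW.
    + by rewrite lerD2l lerN2 ler_sqr// ?nnegrE// ltW.
rewrite integral_cst// -[leRHS]mule1; apply: lee_wpmul2l.
  by rewrite lee_fin powR_ge0.
apply: (@le_trans _ _ (mu `]r, 1[%classic)).
  apply: le_measure; rewrite ?inE// => t [/Ar].
  by rewrite /= !in_itv /= andbT => -> /andP[_ ->].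
by rewrite lebesgue_measure_itv /= lte_fin r1 -EFinB lee_fin gerBl.
Qed.

(** By monotonicity in c it is enough to treat c >= 0, where the weight is bounded
below on ]0, 1/2]. *)
Lemma jacobi_massT_gt0 c : (0 < jacobi_mass c setT)%E.
Proof.
apply: lt_le_trans (jacobi_mass_anti measurableT (_ : c <= Num.max c 0)).
  apply: lt_le_trans (@jacobi_mass_ge _ 0 2^-1 setT _ _ _ _ _ _) => //.
  - rewrite lte_fin mulr_gt0 ?subr_gt0// powR_gt0// subr_gt0.
    by rewrite expr_lt1//; lra.
  - by rewrite le_max lexx orbT.
  - lra.
by rewrite le_max lexx.
Qed.

Lemma powR_le_factor c (a d : R) : c <= 0 -> 0 <= a -> 1 <= d ->
  (a * d) `^ c <= a `^ c.
Proof.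
move=> c0 a0 d1; rewrite powRM// ?(le_trans _ d1)//.
by rewrite ler_piMr ?powR_ge0// -(powRr0 d) ler_powR.
Qed.

(** Only exponents in ]-1, 0] matter by monotonicity. The singularities at -1 and 1
are then separated: on each half of the interval one of the two factors of
1 - t ^+ 2 = (1 - t) * (1 + t) is at least 1, so the weight is at most
(1 - t) `^ c + (1 + t) `^ c, whose terms are translates of s `^ c on ]0, 2[. *)
Lemma jacobi_massT_lty c : -1 < c -> (jacobi_mass c setT < +oo)%E.
Proof.
move=> c1; wlog c0 : c c1 / c <= 0.
  move=> hwlog; have [c0|c0] := leP c 0; first exact: hwlog.
  apply: le_lt_trans (hwlog 0 _ _) => //; exact: jacobi_mass_anti (ltW c0).
pose g (s : R) : \bar R := ((fun s : R => (s `^ c)%:E) \_ `]0, 2[) s.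
have g0 s : (0 <= g s)%E.
  by rewrite /g patchE; case: ifP => // _; rewrite lee_fin powR_ge0.
have mg : measurable_fun [set: R] g.
  apply/(measurable_restrictT _ _).1 => //.
  by apply/measurable_funTS/measurable_EFinP; exact: measurable_powR.
have g_lty : (\int[mu]_s g s < +oo)%E.
  by rewrite -integral_mkcond; exact: integral_powR_lty.
have mgD : measurable_fun [set: R] (fun t => g (1 * t + 1)).
  by apply: measurableT_comp => //; exact: measurable_affine.
have mgN : measurable_fun [set: R] (fun t => g (- t)).
  by apply: measurableT_comp => //; exact: oppr_measurable.
have mgB : measurable_fun [set: R] (fun t => g (- (1 * t + (- 1)))).
  by apply: (measurableT_comp mgN); exact: measurable_affine.
apply: (@le_lt_trans _ _ (\int[mu]_t (g (1 * t + 1)%R + g (- (1 * t + (- 1)))%R))%E).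
  rewrite /jacobi_mass integral_mkcond; apply: ge0_le_integral => //.
  - by move=> t _; rewrite patchE; case: ifP => // _; rewrite lee_fin powR_ge0.
  - apply/(measurable_restrictT _ _).1; first exact: measurableI.
    exact: measurable_jacobi.
  - exact: emeasurable_funD.
  move=> t _; rewrite patchE; case: ifP; last by rewrite adde_ge0.
  rewrite inE /= => -[_]; rewrite in_itv /= => /andP[tN1 t1].
  have [t0|t0] := leP 0 t.
    rewrite -[leLHS]add0e; apply: leeD => //.
    rewrite /g patchE ifT; last by rewrite inE /= in_itv /=; lra.
    rewrite lee_fin (_ : 1 - t ^+ 2 = (- (1 * t - 1)) * (1 + t)); last by ring.
    by apply: powR_le_factor => //; lra.
  rewrite -[leLHS]adde0; apply: leeD => //.
  rewrite /g patchE ifT; last by rewrite inE /= in_itv /=; lra.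
  rewrite lee_fin (_ : 1 - t ^+ 2 = (1 * t + 1) * (1 - t)); last by ring.
  by apply: powR_le_factor => //; lra.
rewrite ge0_integralD//.
have gD : (\int[mu]_t g (1 * t + 1)%R = \int[mu]_t g t)%E.
  by rewrite [RHS](@integral_affine_pos _ _ 1 1)// mul1e.
have gB : (\int[mu]_t g (- (1 * t + (- 1)))%R = \int[mu]_t g t)%E.
  transitivity (\int[mu]_t g (- t)%R)%E; last by rewrite -integral_opp.
  by rewrite (@integral_affine_pos _ (fun t => g (- t)) 1 (- 1))// mul1e.
by rewrite gD gB lte_add_pinfty.
Qed.

End jacobi.

(** * Half-space probabilities of the beta distribution *)

Section beta_tail.
Context {R : realType}.
Implicit Types (n : nat) (b r s u : R).
Local Notation mu := (@lebesgue_measure R).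
Local Notation leb := (@lebesgue_tuple R).

Lemma beta_massS n b : beta_mass b [set: n.+1.-tuple R] =
  (beta_mass b [set: n.-tuple R] * jacobi_mass (b + n%:R / 2) setT)%E.
Proof. exact: (beta_mass_marginal n b measurableT). Qed.

Lemma beta_mass0E b : beta_mass b [set: 0.-tuple R] = 1%E.
Proof.
rewrite beta_massE /= integral_dirac//; last exact: measurable_beta_weight.
have e0 : enorm [tuple] = 0 :> R by rewrite /enorm /dotp big_ord0 sqrtr0.
rewrite diracT mul1e /beta_weight patchE ifT; last by rewrite inE /eball /= e0.
by rewrite /= /beta_density e0 expr0n subr0 powR1.
Qed.

(** Hence the beta distribution is the genuine normalisation of the beta mass.
By [beta_massS] the total mass in dimension n is a product of n one-dimensional
Jacobi masses with exponents b, b + 1/2, ..., all greater than -1. *)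
Lemma beta_massT_gt0_lty n b : -1 < b ->
  (0 < beta_mass b [set: n.-tuple R] < +oo)%E.
Proof.
move=> b1; elim: n => [|n /andP[M0 Moo]]; first by rewrite beta_mass0E lte01 ltry.
rewrite beta_massS mule_gt0 ?jacobi_massT_gt0//=.
rewrite lte_mul_pinfty ?ltW//; first by rewrite ge0_fin_numE// ltW.
apply: jacobi_massT_lty; apply: lt_le_trans b1 _.
by rewrite lerDl divr_ge0.
Qed.

Lemma measurable_slab (rho : R) : measurable [set t : R | 1 < rho * t].
Proof.
rewrite (_ : [set _ | _] = ( *%R rho) @^-1` `]1, +oo[%classic).
  by rewrite -[X in measurable X]setTI; exact: mulrl_measurable.
by apply/seteqP; split => t /=; rewrite in_itv /= andbT.
Qed.

(** The mass in dimension n appears in the numerator and in the total mass, and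
cancels. *)
Lemma beta_distr_halfspace n b (x : n.+1.-tuple R) : -1 < b ->
  beta_distr n.+1 b [set X | 1 < dotp X x] =
  (jacobi_mass (b + n%:R / 2) [set t | (1 < enorm x * t)%R] /
   jacobi_mass (b + n%:R / 2) setT)%E.
Proof.
move=> b1.
have c1 : -1 < b + n%:R / 2 by apply: lt_le_trans b1 _; rewrite lerDl divr_ge0.
have mA : measurable [set t : R | 1 < enorm x * t].
  exact: measurable_slab.
have /andP[MS0 MSoo] := beta_massT_gt0_lty n.+1 b1.
have /andP[M0 Moo] := beta_massT_gt0_lty n b1.
rewrite /beta_distr /= /mnormalize /= ifF; last first.
  by rewrite gt_eqF //= lt_eqF.
rewrite beta_mass_halfspace.
rewrite (beta_mass_marginal n b mA) beta_massS.
have := jacobi_massT_lty c1; have := @jacobi_massT_gt0 _ (b + n%:R / 2).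
have := jacobi_mass_subset (b + n%:R / 2) mA measurableT (@subsetT _ _).
have := jacobi_mass_ge0 (b + n%:R / 2) [set t | (1 < enorm x * t)%R].
move: M0 Moo (jacobi_mass _ _) (jacobi_mass _ _) => + + a j.
move: (beta_mass b _) a j => [m||] [a||] [j||]//; rewrite ?lte_fin ?leye_eq//.
move=> m0 _ _ _ j0 _.
rewrite -!EFinM /= inver gt_eqF// -!EFinM; congr EFin; field.
by rewrite !gt_eqF.
Qed.

(** The numerator only sees t > r. The denominator is at least the mass of
]0, delta]; taking delta small makes the loss against the maximum 1 of the weight
as small as desired on the exponential scale. *)
Lemma beta_distr_halfspace_le n b r (delta : R) (x : n.+1.-tuple R) : -1 < b ->
  0 <= b + n%:R / 2 -> 0 < r < 1 -> 0 < delta < 1 -> enorm x <= r^-1 ->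
  (beta_distr n.+1 b [set X | (1 < dotp X x)%R] <=
   (delta^-1 * ((1 - r ^+ 2) / (1 - delta ^+ 2)) `^ (b + n%:R / 2))%:E)%E.
Proof.
move=> b1 c0 /andP[r0 r1] /andP[d0 d1] xr; rewrite beta_distr_halfspace//.
set c := b + n%:R / 2 in c0 *.
have ub : (jacobi_mass c [set t | (1 < enorm x * t)%R] <= ((1 - r ^+ 2) `^ c)%:E)%E.
  apply: jacobi_mass_le => //; [exact: ltW|exact: measurable_slab|].
  move=> t /= xt; rewrite in_itv /= andbT.
  have t0 : 0 < t.
    rewrite ltNge; apply/negP => t0; have := lt_trans ltr01 xt.
    by rewrite ltNge mulr_ge0_le0 ?enorm_ge0.
  rewrite -[r]mulr1 -ltr_pdivlMl//; apply: lt_le_trans xt _.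
  by rewrite ler_wpM2r// ltW.
have lb : ((delta * (1 - delta ^+ 2) `^ c)%:E <= jacobi_mass c setT)%E.
  by rewrite -[X in (X * _)%R]subr0; apply: jacobi_mass_ge => //; exact: ltW.
have k0 (y : R) : 0 < y -> y < 1 -> 0 < 1 - y ^+ 2.
  by move=> y0 y1; rewrite subr_gt0 expr_lt1// ltW.
have := jacobi_mass_ge0 c [set t | (1 < enorm x * t)%R].
have := jacobi_massT_lty (lt_le_trans (ltrN10 _) c0).
move: (jacobi_mass c [set t | _]) (jacobi_mass c setT) ub lb => [a||] [j||]//.
rewrite !lee_fin => ub lb _ a0.
have p0 := powR_gt0 c (k0 _ d0 d1).
have j0 : 0 < j by apply: lt_le_trans lb; exact: mulr_gt0.
rewrite inver gt_eqF// -EFinM lee_fin ler_pdivrMr//.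
have [/ltW r2 /ltW d2] := (k0 _ r0 r1, k0 _ d0 d1).
rewrite powRM ?invr_ge0// -[(1 - delta ^+ 2)^-1]powR_inv1//.
rewrite -powRrM mulN1r powRN.
apply: (le_trans ub); rewrite mulrCA -mulrA ler_peMr ?powR_ge0//.
by rewrite -invfM mulrC ler_pdivlMr ?mulr_gt0// mul1r.
Qed.

(** The numerator sees all of ]s, u], and the total mass is at most 2. *)
Lemma beta_distr_halfspace_ge n b s u (x : n.+1.-tuple R) : -1 < b ->
  0 <= b + n%:R / 2 -> 0 < s -> s < u -> u < 1 -> s^-1 <= enorm x ->
  (((u - s) / 2 * (1 - u ^+ 2) `^ (b + n%:R / 2))%:E <=
   beta_distr n.+1 b [set X | (1 < dotp X x)%R])%E.
Proof.
move=> b1 c0 s0 su u1 xs; rewrite beta_distr_halfspace//.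
set c := b + n%:R / 2 in c0 *.
have lb : (((u - s) * (1 - u ^+ 2) `^ c)%:E <=
    jacobi_mass c [set t | (1 < enorm x * t)%R])%E.
  apply: jacobi_mass_ge => //; [exact: ltW|exact: ltW|exact: measurable_slab|].
  move=> t /=; rewrite in_itv /= => /andP[st _].
  rewrite -(mulVf (lt0r_neq0 s0)); apply: (@lt_le_trans _ _ (s^-1 * t)).
    by rewrite ltr_pM2l// invr_gt0.
  by rewrite ler_wpM2r// (le_trans (ltW s0))// ltW.
have := jacobi_massT_le2 c0; have := @jacobi_massT_gt0 _ c.
have := jacobi_mass_subset c (measurable_slab (enorm x)) measurableT (@subsetT _ _).
move: (jacobi_mass c [set t | _]) (jacobi_mass c setT) lb => [a||] [j||]//.
rewrite !lee_fin lte_fin => lb _ j0 j2.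
rewrite inver gt_eqF// -EFinM lee_fin ler_pdivlMr//.
apply: le_trans lb.
rewrite [leLHS](_ : _ = (u - s) * (1 - u ^+ 2) `^ c * (j / 2)); last by field.
rewrite ler_piMr//; last by rewrite ler_pdivrMr// mul1r.
by rewrite mulr_ge0 ?powR_ge0// subr_ge0 ltW.
Qed.

End beta_tail.

(** * The expected volume of the random polytope *)

Section ball_volume.
Context {R : realType}.
Local Notation leb := (@lebesgue_tuple R).

Lemma eball_scale n (rho : R) : 0 < rho ->
  leb n (eball rho) = ((rho ^+ n)%:E * leb n (eball 1))%E.
Proof.
move=> rho0; have mE r := @measurable_eball R n r.
have indE r : (\int[leb n]_x (\1_(eball r) x)%:E = leb n (eball r))%E.
  by rewrite integral_indic ?setIT.
rewrite -!indE (@integral_axpy _ _ _ rho [tuple 0 | i < n])//; last first.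
  by apply/measurable_EFinP; exact: measurable_indic.
congr (_ * _)%E; apply: eq_integral => x _; congr EFin.
rewrite !indicE; congr ((_ : bool)%:R).
have rE : (enorm (axpy rho x [tuple 0 | i < n]) <= rho) = (enorm x <= 1).
  rewrite !enorm_le ?(ltW rho0)// !(dotp_axpyl, dotp_axpyr) (dotpC _ x) !dotp_zero.
  by rewrite mulr0 !addr0 mulrA -expr2 expr1n -{2}[rho ^+ 2]mulr1 ler_pM2l// exprn_gt0.
by apply/idP/idP; rewrite !inE /eball /= rE.
Qed.

Lemma bernoulli_le (a : R) k : 0 <= a <= 1 -> 1 - k%:R * a <= (1 - a) ^+ k.
Proof.
move=> /andP[a0 a1]; elim: k => [|k IHk]; first by rewrite expr0 mul0r subr0.
rewrite exprSr -natr1; apply: le_trans (ler_wpM2r _ IHk); last by rewrite subr_ge0.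
rewrite -subr_ge0 (_ : _ - _ = k%:R * a ^+ 2); last by ring.
by rewrite mulr_ge0// sqr_ge0.
Qed.

End ball_volume.

Section expected_volume.
Context {R : realType} d {T : measurableType d} (P : probability T R).
Context (n N : nat) (X : 'I_N -> {RV P >-> (n.-tuple R)}).
Context (Q : probability (n.-tuple R) R).
Hypothesis X_indep : mutually_independent X.
Hypothesis X_law : forall i A, measurable A -> distribution P (X i) A = Q A.
Local Notation leb := (@lebesgue_tuple R).

Definition cut_prob (x : n.-tuple R) : R := fine (Q [set y | 1 < dotp y x]).

Lemma cut_probE x : Q [set y | 1 < dotp y x] = (cut_prob x)%:E.
Proof. by rewrite /cut_prob fineK// fin_num_measure//; exact: measurable_halfspace. Qed.

Lemma cut_prob_itv x : 0 <= cut_prob x <= 1.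
Proof.
rewrite -!lee_fin -cut_probE measure_ge0 /=; apply: probability_le1.
exact: measurable_halfspace.
Qed.

Lemma measurable_polytope_graph rho : measurable
  [set wx : T * n.-tuple R | (forall i, dotp (X i wx.1) wx.2 <= 1) /\ enorm wx.2 <= rho].
Proof.
have -> : [set wx : T * n.-tuple R |
      (forall i, dotp (X i wx.1) wx.2 <= 1) /\ enorm wx.2 <= rho] =
    (\bigcap_(i in [set: 'I_N]) ((fun wx => dotp (X i wx.1) wx.2) @^-1` `]-oo, 1]%classic))
    `&` snd @^-1` eball rho.
  apply/seteqP; split=> -[w x] /= [h1 h2]; split => //.
    by move=> i _; rewrite /= in_itv /=; exact: h1.
  by move=> i; have := h1 i I; rewrite /= in_itv.
apply: measurableI; last first.
  by rewrite -[X in measurable X]setTI; apply: measurable_snd => //; exact: measurable_eball.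
apply: fin_bigcap_measurable => // i _.
rewrite -[X in measurable X]setTI; apply: measurable_dotp_fun => //.
by apply: measurableT_comp.
Qed.

Lemma prob_in_polytope x :
  P [set w | forall i, dotp (X i w) x <= 1] = ((1 - cut_prob x) ^+ N)%:E.
Proof.
pose B := [set y : n.-tuple R | dotp y x <= 1].
have BC : B = ~` [set y | 1 < dotp y x].
  by apply/seteqP; split => y; rewrite /B /= leNgt => /negP.
have mB : measurable B by rewrite BC; apply: measurableC; exact: measurable_halfspace.
have := X_indep [set: 'I_N]%SET (fun=> mB).
rewrite (_ : \bigcap_(i in _) _ = [set w | forall i, dotp (X i w) x <= 1]); last first.
  by apply/seteqP; split => w h i; [apply: h; rewrite /= inE|move=> _; exact: h].
move=> ->; rewrite (eq_bigr (fun=> (1 - cut_prob x)%:E)); last first.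
  move=> i _; rewrite -[LHS]/(distribution P (X i) B) X_law// BC.
  by rewrite probability_setC ?cut_probE//; exact: measurable_halfspace.
by rewrite prodEFin prodr_const cardsT card_ord.
Qed.

Lemma measurable_cut_prob : measurable_fun setT cut_prob.
Proof.
pose A := [set yx : n.-tuple R * n.-tuple R | 1 < dotp yx.1 yx.2].
have mA : measurable A.
  rewrite (_ : A = (fun yx => dotp yx.1 yx.2) @^-1` `]1, +oo[%classic).
    by rewrite -[X in measurable X]setTI; exact: measurable_dotp_fun.
  by apply/seteqP; split => yx /=; rewrite in_itv /= andbT.
apply/measurable_EFinP.
rewrite (_ : _ \o _ = Q \o ysection A); first exact: measurable_fun_ysection.
apply/funext => x /=; rewrite -cut_probE; congr (Q _).
by apply/seteqP; split => y; rewrite /ysection /= inE.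
Qed.

(** Tonelli: a point x of the ball belongs to the random polytope with probability
(1 - cut_prob x) ^+ N, by independence. *)
Lemma expected_volumeE rho :
  ('E_P[fun w => fine (leb n (polytope (fun i => X i w) `&` eball rho))] =
   \int[leb n]_(x in eball rho) ((1 - cut_prob x) ^+ N)%:E)%E.
Proof.
pose A := [set wx : T * n.-tuple R |
  (forall i, dotp (X i wx.1) wx.2 <= 1) /\ enorm wx.2 <= rho].
have mA : measurable A := measurable_polytope_graph rho.
pose f (wx : T * n.-tuple R) : \bar R := (\1_A wx)%:E.
have mf : measurable_fun setT f by exact/measurable_EFinP/measurable_indic.
have f0 wx : (0 <= f wx)%E by rewrite lee_fin.
rewrite unlock.
transitivity (\int[P]_w \int[leb n]_x f (w, x))%E.
  apply: eq_integral => w _.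
  have mH : measurable (polytope (fun i => X i w) `&` eball rho).
    rewrite (_ : _ `&` _ = xsection A w); first exact: measurable_xsection.
    by apply/seteqP; split => x; rewrite /xsection /= inE.
  have fE x : f (w, x) = (\1_(polytope (fun i => X i w) `&` eball rho) x)%:E.
    by rewrite /f; congr EFin; rewrite !indicE; congr ((_ : bool)%:R).
  under eq_integral do rewrite fE.
  rewrite integral_indic// setIT fineK// ge0_fin_numE//.
  apply: le_lt_trans (eball_lty n rho); apply: le_measure; rewrite ?inE//.
  exact: measurable_eball.
rewrite (@fubini_tonelli _ _ _ _ _ P (leb n) f)// [RHS]integral_mkcond.
apply: eq_integral => x _; rewrite patchE.
case: ifPn => [|/negP xB].
  rewrite inE => xB; rewrite -prob_in_polytope.
  have fE w : f (w, x) = (\1_[set w | forall i, dotp (X i w) x <= 1] w)%:E.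
    rewrite /f; congr EFin; rewrite !indicE; congr ((_ : bool)%:R).
    by apply/idP/idP; rewrite !inE //= => -[].
  under eq_integral do rewrite fE.
  rewrite integral_indic ?setIT//.
  rewrite (_ : [set w | _] = ysection A x); first exact: measurable_ysection.
  by apply/seteqP; split => w; rewrite /ysection /= inE //= => -[].
apply: integral0_eq => w _; rewrite /f indicE memNset// => -[_ xr].
by apply: xB; rewrite inE.
Qed.

Section ratio.
Variable r : R.
Hypothesis r0 : 0 < r.
Let V := fine (leb n (eball r^-1)).

Let VE : leb n (eball r^-1) = V%:E.
Proof. by rewrite /V fineK// ge0_fin_numE// eball_lty. Qed.

Let V0 : 0 < V.
Proof. by rewrite -lte_fin -VE eball_gt0// invr_gt0. Qed.

Lemma measurable_cut_exp (D : set (n.-tuple R)) :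
  measurable_fun D (fun x => ((1 - cut_prob x) ^+ N)%:E).
Proof.
apply/measurable_funTS/measurable_EFinP; apply: measurable_funX.
by apply: measurable_funB => //; exact: measurable_cut_prob.
Qed.

Lemma cut_exp_ge0 x : 0 <= (1 - cut_prob x) ^+ N.
Proof. by have /andP[_ h] := cut_prob_itv x; rewrite exprn_ge0// subr_ge0. Qed.

Lemma cut_exp_le1 x : (1 - cut_prob x) ^+ N <= 1.
Proof.
have /andP[h0 h] := cut_prob_itv x.
by rewrite exprn_ile1// ?subr_ge0// lerBlDr lerDl.
Qed.

Let I := (\int[leb n]_(x in eball r^-1) ((1 - cut_prob x) ^+ N)%:E)%E.

Let I_ge0 : (0 <= I)%E.
Proof. by apply: integral_ge0 => x _; rewrite lee_fin cut_exp_ge0. Qed.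

Let I_le : (I <= V%:E)%E.
Proof.
rewrite /I -VE -[leRHS]mul1e -integral_cst; last exact: measurable_eball.
apply: ge0_le_integral => //; first exact: measurable_eball.
- by move=> x _; rewrite lee_fin cut_exp_ge0.
- exact: measurable_cut_exp.
- by move=> x _; rewrite lee_fin cut_exp_le1.
Qed.

Let ratioE : expected_volume_ratio X r = fine I / V.
Proof. by rewrite /expected_volume_ratio expected_volumeE. Qed.

Let fineI : I = (fine I)%:E.
Proof. by rewrite fineK// ge0_fin_numE// (le_lt_trans I_le)// ltry. Qed.

Lemma expected_volume_ratio_ge0 : 0 <= expected_volume_ratio X r.
Proof.
rewrite /expected_volume_ratio divr_ge0 ?fine_ge0// unlock.
by apply: integral_ge0 => w _; rewrite lee_fin fine_ge0.
Qed.

Lemma expected_volume_ratio_le1 : expected_volume_ratio X r <= 1.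
Proof. by rewrite ratioE ler_pdivrMr// mul1r -lee_fin -fineI. Qed.

Lemma expected_volume_ratio_ge p : (forall x, enorm x <= r^-1 -> cut_prob x <= p) ->
  1 - N%:R * p <= expected_volume_ratio X r.
Proof.
move=> cutp; have [neg|pos] := ltP (1 - N%:R * p) 0.
  exact: le_trans (ltW neg) expected_volume_ratio_ge0.
rewrite ratioE ler_pdivlMr// -lee_fin -fineI EFinM -VE.
rewrite -integral_cst; last exact: measurable_eball.
apply: ge0_le_integral => //; first exact: measurable_eball.
- exact: measurable_cut_exp.
- move=> x xB; rewrite lee_fin.
  apply: le_trans (bernoulli_le N (cut_prob_itv x)).
  by rewrite lerD2l lerN2 ler_wpM2l// cutp.
Qed.

Lemma expected_volume_ratio_le s q : 0 < s -> 0 <= q <= 1 ->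
  (forall x, s^-1 <= enorm x -> q <= cut_prob x) ->
  expected_volume_ratio X r <= (r / s) ^+ n + (1 - q) ^+ N.
Proof.
move=> s0 /andP[q0 q1] cutq.
have mB t := @measurable_eball R n t.
have q1N : 0 <= (1 - q) ^+ N by rewrite exprn_ge0// subr_ge0.
have mind D : measurable_fun D (fun x : n.-tuple R => (\1_(eball s^-1) x)%:E : \bar R).
  by apply/measurable_funTS/measurable_EFinP; exact: measurable_indic.
rewrite ratioE ler_pdivrMr// mulrDl -lee_fin -fineI EFinD.
have -> : ((r / s) ^+ n * V)%:E = leb n (eball s^-1).
  have s0' : 0 < s^-1 by rewrite invr_gt0.
  have r0' : 0 < r^-1 by rewrite invr_gt0.
  rewrite (eball_scale n s0') EFinM -[X in (_ * X)%E]VE (eball_scale n r0').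
  rewrite muleA -EFinM -exprMn; congr ((_ ^+ _)%:E * _)%E.
  by rewrite mulrAC divff ?mul1r// gt_eqF.
apply: (@le_trans _ _ (\int[leb n]_(x in eball r^-1)
    ((\1_(eball s^-1) x)%:E + ((1 - q) ^+ N)%:E))%E).
  (* Inside the smaller ball the integrand is bounded by 1, outside by the power
     of 1 - q. *)
  apply: ge0_le_integral => //.
  - by move=> x _; rewrite lee_fin cut_exp_ge0.
  - exact: measurable_cut_exp.
  - by apply: emeasurable_funD.
  move=> x _; rewrite -EFinD lee_fin indicE.
  have [xs|xs] := leP (enorm x) s^-1.
    by rewrite mem_set//= (le_trans (cut_exp_le1 x))// lerDl.
  have /andP[c0 c1] := cut_prob_itv x.
  rewrite memNset/= ?add0r; last by rewrite /eball /= leNgt xs.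
  by rewrite lerXn2r ?nnegrE ?subr_ge0// lerD2l lerN2 cutq// ltW.
rewrite ge0_integralD//.
apply: leeD; last by rewrite integral_cst//= EFinM -[X in (_ <= _ * X)%E]VE.
by rewrite integral_indic//; apply: le_measure; rewrite ?inE//; exact: measurableI.
Qed.

End ratio.

End expected_volume.

(** * Geometric error bounds on both sides of the threshold *)

Section threshold.
Context {R : realType}.
Implicit Types (eps r b : R).

Lemma sqrt_onem_expR_itv (x : R) : 0 < x -> 0 < Num.sqrt (1 - expR (- x)) < 1.
Proof.
move=> x0; have x1 : expR (- x) < 1 by rewrite -expR0 ltr_expR oppr_lt0.
rewrite sqrtr_gt0 subr_gt0 x1 /= -[X in _ < X]sqrtr1 ltr_sqrt//.
by rewrite ltrBlDr ltrDl expR_gt0.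
Qed.

Lemma onem_sqr_sqrt (x : R) : 0 < x ->
  1 - Num.sqrt (1 - expR (- x)) ^+ 2 = expR (- x).
Proof.
move=> x0; rewrite sqr_sqrtr; first by ring.
by rewrite subr_ge0 -expR0 ler_expR oppr_le0 ltW.
Qed.

(** Equivalent to (1 - q) ^+ k <= (1 + k q)^-1: a decay of order 1 / (k q) is
enough, because k q will grow geometrically. *)
Lemma onem_exprM_le (q : R) k : 0 <= q <= 1 -> (1 - q) ^+ k * (1 + k%:R * q) <= 1.
Proof.
move=> /andP[q0 q1]; elim: k => [|k IHk]; first by rewrite expr0 mul0r addr0 mulr1.
apply: le_trans IHk; rewrite exprSr -mulrA ler_wpM2l ?exprn_ge0 ?subr_ge0//.
rewrite -natr1 -subr_ge0 [leRHS](_ : _ = (k%:R + 1) * q ^+ 2); last by ring.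
by rewrite mulr_ge0// ?sqr_ge0// addr_ge0.
Qed.

Lemma ln_inv_onem_sqr_gt0 r : 0 < r -> r < 1 -> 0 < ln ((1 - r ^+ 2)^-1).
Proof.
move=> r0 r1; have r2 : 0 < 1 - r ^+ 2 by rewrite subr_gt0 expr_lt1// ltW.
by rewrite ln_gt0// invf_gt1// ltrBlDr ltrDl exprn_gt0.
Qed.

Lemma onem_sqrE r : 0 < r -> r < 1 ->
  1 - r ^+ 2 = expR (- ln ((1 - r ^+ 2)^-1)).
Proof.
move=> r0 r1; have r2 : 0 < 1 - r ^+ 2 by rewrite subr_gt0 expr_lt1// ltW.
by rewrite expRN lnK ?posrE ?invr_gt0// invrK.
Qed.

(** The point of the statement is the uniformity: C and k depend on eps and r only.
Here delta is chosen so that 1 - delta ^+ 2 = exp (- eps L / 2), which costs half of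
the available margin: the bound on N times the half-space probability has exponent
at most (1 - eps) (c + 1) L - (1 - eps / 2) c L = (1 - eps) L - c eps L / 2, and
c > m / 2 - 1. *)
Lemma subcritical_bound eps r : 0 < eps -> eps < 1 -> 0 < r -> r < 1 ->
  exists C k : R, [/\ 0 < k, k < 1 &
    forall d (T : measurableType d) (P : probability T R) (m N : nat) b
      (X : 'I_N -> {RV P >-> (m.+1.-tuple R)}),
    (1 < m)%N -> -1 < b -> mutually_independent X ->
    (forall i A, measurable A -> distribution P (X i) A = beta_distr m.+1 b A) ->
    N%:R <= expR ((1 - eps) * (b + m.+2%:R / 2) * ln ((1 - r ^+ 2)^-1)) ->
    1 - C * k ^+ m.+1 <= expected_volume_ratio X r].
Proof.
move=> eps0 eps1 r0 r1; have L0 := ln_inv_onem_sqr_gt0 r0 r1.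
have rE := onem_sqrE r0 r1.
set L := ln _ in L0 rE *.
have e0 : 0 < eps * L / 2 by rewrite divr_gt0// mulr_gt0.
pose delta := Num.sqrt (1 - expR (- (eps * L / 2))).
have dE : 1 - delta ^+ 2 = expR (- (eps * L / 2)) := onem_sqr_sqrt e0.
have /andP[d0 d1] : 0 < delta < 1 := sqrt_onem_expR_itv e0.
exists (delta^-1 * expR ((1 - eps / 4) * L)), (expR (- (eps * L / 4))); split.
- exact: expR_gt0.
- by rewrite -expR0 ltr_expR oppr_lt0 divr_gt0// mulr_gt0.
move=> d T P m N b X m1 b1 Xi XQ NN.
have m2 : 2 <= m%:R :> R by rewrite ler_nat.
pose c := b + m%:R / 2; have c0 : 0 <= c by rewrite /c; lra.
have cE : b + m.+2%:R / 2 = c + 1 by rewrite /c -addn2 natrD; field.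
have := @expected_volume_ratio_ge _ _ _ P _ _ X _ Xi XQ _ r0
  (delta^-1 * expR (- (c * (1 - eps / 2) * L))).
have cutp x : enorm x <= r^-1 ->
    cut_prob (beta_distr m.+1 b) x <= delta^-1 * expR (- (c * (1 - eps / 2) * L)).
  move=> xr; rewrite -lee_fin -cut_probE.
  have := @beta_distr_halfspace_le _ m b r delta x b1 c0 _ _ xr.
  rewrite r0 r1 d0 d1 -/c => /(_ isT isT) /le_trans; apply.
  rewrite lee_fin rE dE -expRN -expRD -expRM.
  by rewrite (_ : _ * c = - (c * (1 - eps / 2) * L))//; field.
move=> /(_ cutp) /(le_trans _); apply.
rewrite lerD2l lerN2 mulrCA -[leRHS]mulrA ler_wpM2l ?invr_ge0 ?(ltW d0)//.
apply: le_trans (ler_wpM2r (expR_ge0 _) NN) _.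
rewrite cE -expRM_natl -!expRD ler_expR.
rewrite -subr_ge0 -natr1.
rewrite [leRHS](_ : _ = (b + 1) * (eps * L / 2)); last by rewrite /c; field.
by rewrite mulr_ge0 ?(ltW e0)//; lra.
Qed.

(** Here u is chosen so that 1 - u ^+ 2 = exp (- (1 + eps / 2) L), again half of the
margin, and s is the midpoint of r and u. Then N times the half-space probability at
distance s^-1 is at least (u - s) / 2 * exp (c eps L / 2), with c > m / 2 - 1. *)
Lemma supercritical_bound eps r : 0 < eps -> 0 < r -> r < 1 ->
  exists C k s : R, [/\ 0 < k, k < 1, r < s &
    forall d (T : measurableType d) (P : probability T R) (m N : nat) b
      (X : 'I_N -> {RV P >-> (m.+1.-tuple R)}),
    (1 < m)%N -> -1 < b -> mutually_independent X ->
    (forall i A, measurable A -> distribution P (X i) A = beta_distr m.+1 b A) ->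
    N%:R >= expR ((1 + eps) * (b + m.+2%:R / 2) * ln ((1 - r ^+ 2)^-1)) ->
    expected_volume_ratio X r <= (r / s) ^+ m.+1 + C * k ^+ m.+1].
Proof.
move=> eps0 r0 r1; have L0 := ln_inv_onem_sqr_gt0 r0 r1.
have rE := onem_sqrE r0 r1.
set L := ln _ in L0 rE *.
have e0 : 0 < (1 + eps / 2) * L by rewrite mulr_gt0//; lra.
pose u := Num.sqrt (1 - expR (- ((1 + eps / 2) * L))).
have uE : 1 - u ^+ 2 = expR (- ((1 + eps / 2) * L)) := onem_sqr_sqrt e0.
have /andP[u0 u1] : 0 < u < 1 := sqrt_onem_expR_itv e0.
have ru : r < u.
  rewrite -(@ltr_pXn2r _ 2) ?nnegrE ?(ltW r0) ?(ltW u0)//.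
  rewrite -ltrN2 -(ltrD2l 1) uE rE ltr_expR ltrN2 mulrDl mul1r ltrDl.
  by rewrite mulr_gt0// divr_gt0.
pose s := (r + u) / 2.
have rs : r < s by rewrite /s; lra.
have su : s < u by rewrite /s; lra.
have s0 : 0 < s := lt_trans r0 rs.
exists (2 / (u - s) * expR (3 / 4 * (eps * L))), (expR (- (eps * L / 4))), s.
split => //.
- exact: expR_gt0.
- by rewrite -expR0 ltr_expR oppr_lt0 divr_gt0// mulr_gt0.
move=> d T P m N b X m1 b1 Xi XQ NN.
have m2 : 2 <= m%:R :> R by rewrite ler_nat.
pose c := b + m%:R / 2; have c0 : 0 <= c by rewrite /c; lra.
have cE : b + m.+2%:R / 2 = c + 1 by rewrite /c -addn2 natrD; field.
pose q := (u - s) / 2 * expR (- (c * (1 + eps / 2) * L)).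
have q0 : 0 < q by rewrite mulr_gt0 ?expR_gt0// divr_gt0// subr_gt0.
have q1 : q <= 1.
  rewrite mulr_ile1 ?expR_ge0//; [by lra|by lra|].
  rewrite -[leRHS]expR0 ler_expR oppr_le0; apply: mulr_ge0; last exact: ltW.
  by apply: mulr_ge0 => //; lra.
have q01 : 0 <= q <= 1 by rewrite (ltW q0).
have := @expected_volume_ratio_le _ _ _ P _ _ X _ Xi XQ _ r0 s q s0 q01.
have cutq x : s^-1 <= enorm x -> q <= cut_prob (beta_distr m.+1 b) x.
  move=> xs; rewrite -lee_fin -cut_probE.
  apply: le_trans (@beta_distr_halfspace_ge _ m b s u x b1 c0 s0 su u1 xs).
  rewrite lee_fin uE -expRM /q -/c ler_wpM2l//; first lra.
  by rewrite ler_expR mulNr (mulrC _ c) mulrA.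
move=> /(_ cutq) /le_trans; apply.
rewrite lerD2l.
have Nq0 : 0 < 1 + N%:R * q by rewrite ltr_wpDr// mulr_ge0// ltW.
apply: (@le_trans _ _ (1 + N%:R * q)^-1).
  by rewrite -[leRHS]mul1r ler_pdivlMr// onem_exprM_le.
apply: (@le_trans _ _ ((u - s) / 2 * expR (c * (eps * L / 2)))^-1).
  have su0 : 0 < (u - s) / 2 by lra.
  rewrite lef_pV2 ?posrE//; last by rewrite mulr_gt0// expR_gt0.
  apply: (@le_trans _ _ (N%:R * q)); last by rewrite lerDr.
  rewrite /q [leRHS]mulrCA ler_pM2l//; apply: le_trans (ler_wpM2r (expR_ge0 _) NN).
  rewrite -expRD ler_expR cE -subr_ge0.
  rewrite [leRHS](_ : _ = (1 + eps) * L); last by field.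
  by rewrite mulr_ge0 ?(ltW L0)//; lra.
rewrite invfM invf_div -[leRHS]mulrA ler_wpM2l//.
  by rewrite divr_ge0// subr_ge0 ltW.
rewrite -expRN -expRM_natl -expRD ler_expR -subr_ge0 -natr1.
rewrite [leRHS](_ : _ = (b + 1) * (eps * L / 2)); last by rewrite /c; field.
by apply: mulr_ge0; [lra|rewrite divr_ge0// mulr_ge0//; exact: ltW].
Qed.

End threshold.

Lemma cvg_geometric_const {R : realType} (C k : R) : 0 < k -> k < 1 ->
  C * k ^+ n @[n --> \oo] --> (0 : R).
Proof.
move=> k0 k1; rewrite -(mulr0 C).
by apply: cvgM; [exact: cvg_cst|apply: cvg_expr; rewrite gtr0_norm].
Qed.

Theorem theorem4p1 (R : realType) (eps r : R) (beta : nat -> R) (N : nat -> nat)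
    (d : nat -> measure_display) (Omega : forall n, measurableType (d n))
    (P : forall n, probability (Omega n) R)
    (X : forall n, 'I_(N n) -> {RV (P n) >-> (n.-tuple R)}) :
  0 < eps -> eps < 1 -> 0 < r -> r < 1 ->
  (forall n, (0 < n)%N -> -1 < beta n) ->
  (forall n, (0 < n)%N -> (n < N n)%N) ->
  (forall n, (0 < n)%N -> mutually_independent (X n)) ->
  (forall n, (0 < n)%N -> forall (i : 'I_(N n)) (A : set (n.-tuple R)),
    measurable A -> distribution (P n) (X n i) A = beta_distr n (beta n) A) ->
  ((\forall n \near \oo, (N n)%:R <=
      expR ((1 - eps) * (beta n + n.+1%:R / 2) * ln ((1 - r ^+ 2)^-1))) ->
    expected_volume_ratio (X n) r @[n --> \oo] --> (1 : R)) /\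
  ((\forall n \near \oo, (N n)%:R >=
      expR ((1 + eps) * (beta n + n.+1%:R / 2) * ln ((1 - r ^+ 2)^-1))) ->
    expected_volume_ratio (X n) r @[n --> \oo] --> (0 : R)).
Proof.
move=> eps0 eps1 r0 r1 b1 _ Xi XQ; split => NN.
- have [C [k [k0 k1 bound]]] := subcritical_bound eps0 eps1 r0 r1.
  apply: (@squeeze_cvgr _ _ _ _ (fun n => 1 - C * k ^+ n) (cst 1)); last 2 first.
  + rewrite -[X in _ --> X]subr0; apply: cvgB; first exact: cvg_cst.
    exact: cvg_geometric_const.
  + exact: cvg_cst.
  (* From dimension 3 on, the exponent of the first marginal is nonnegative. *)
  apply: filterS2 (nbhs_infty_gt 2) NN => -[//|m] m1 Nm.
  have [Xim XQm] := (Xi m.+1 isT, XQ m.+1 isT).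
  rewrite (bound _ _ _ _ _ _ _ m1 (b1 m.+1 isT) Xim XQm Nm) /=.
  exact: (expected_volume_ratio_le1 Xim XQm r0).
- have [C [k [s [k0 k1 rs bound]]]] := supercritical_bound eps0 r0 r1.
  have s0 : 0 < s := lt_trans r0 rs.
  apply: (@squeeze_cvgr _ _ _ _ (cst 0) (fun n => (r / s) ^+ n + C * k ^+ n));
    last 2 first.
  + exact: cvg_cst.
  + rewrite -[X in _ --> X]addr0; apply: cvgD; last exact: cvg_geometric_const.
    by apply: cvg_expr; rewrite gtr0_norm ?divr_gt0// ltr_pdivrMr// mul1r.
  apply: filterS2 (nbhs_infty_gt 2) NN => -[//|m] m1 Nm.
  have [Xim XQm] := (Xi m.+1 isT, XQ m.+1 isT).
  rewrite (bound _ _ _ _ _ _ _ m1 (b1 m.+1 isT) Xim XQm Nm) andbT /=.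
  exact: expected_volume_ratio_ge0.
Qed.
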